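(* Let $\gamma_x,\gamma_y\ge0$ be constants, let $\sigma=\sigma(x)\ge0$ be the damping function and $\sigma_\infty=\max_x\sigma(x)$. Consider, on $[-x_0-\delta,x_0+\delta]\times[-y_0,y_0]$, the perfectly matched layer in first order form $$\frac{\partial E_z}{\partial t}=-\frac{\partial H_y}{\partial x}+\frac{\partial H_x}{\partial y}+H_x^*-\sigma E_z,\quad \frac{\partial H_y}{\partial t}=-\frac{\partial E_z}{\partial x}-\sigma H_y,\quad \frac{\partial H_x}{\partial t}=\frac{\partial E_z}{\partial y},\quad \frac{\partial H_x^*}{\partial t}=\sigma\frac{\partial H_x}{\partial y},$$ or in the second order form $$\frac{\partial^2E_z}{\partial t^2}+\sigma\frac{\partial E_z}{\partial t}=\frac{\partial}{\partial x}\left(\frac{\partial E_z}{\partial x}+\sigma H_y\right)+\frac{\partial}{\partial y}\left(\frac{\partial E_z}{\partial y}+\sigma H_x\right),\quad \frac{\partial H_y}{\partial t}=-\frac{\partial E_z}{\partial x}-\sigma H_y,\quad \frac{\partial H_x}{\partial t}=\frac{\partial E_z}{\partial y}.$$ (a) All solutions subject to the boundary conditions $$\gamma_yE_z\pm H_x=0,\ \text{ implying }\ \gamma_y\frac{\partial E_z}{\partial t}+\sigma\gamma_yE_z\pm\left(\frac{\partial E_z}{\partial y}+\sigma H_x\right)=0,\quad\text{at } y=\pm y_0,$$ $$\gamma_xE_z\mp H_y=0,\ \text{ implying }\ \gamma_x\frac{\partial E_z}{\partial t}\pm\left(\frac{\partial E_z}{\partial x}+\sigma H_y\right)=0,\quad\text{at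 } x=\pm(x_0+\delta)$$ (the first form for the first order system, the implied form for the second order system) satisfy $$\frac{d}{dt}\sqrt{\mathcal{E}^{(1)}_\sigma(t)}\le\sigma_\infty\sqrt{\mathcal{E}^{(1)}_\sigma(t)}.$$ (b) All solutions subject to the boundary conditions $E_z=0$, implying $\partial E_z/\partial t=0$, at $y=\pm y_0$ and at $x=\pm(x_0+\delta)$ satisfy $$\frac{d}{dt}\sqrt{\mathcal{E}^{(0)}_\sigma(t)}\le\sigma_\infty\sqrt{\mathcal{E}^{(0)}_\sigma(t)}.$$ The energies $\mathcal{E}^{(1)}_\sigma$, $\mathcal{E}^{(0)}_\sigma$ are defined in the context.
   Context: $x_0,y_0,\delta>0$. The damping $\sigma(x)\ge0$ is a real function of $x$ only, vanishing for $|x|\le x_0$. All fields are real-valued functions of $(x,y,t)$, $t\ge0$; $\sigma$ and the solutions are assumed sufficiently smooth up to the boundary. $\|\cdot\|$ is the $L^2$ norm on the rectangle. $\Gamma_x=\{x:-x_0-\delta\le x\le x_0+\delta\}$, $\Gamma_y=\{y:-y_0\le y\le y_0\}$. The energies are $$\mathcal{E}^{(0)}_\sigma(t)=\left\|\frac{\partial E_z}{\partial t}\right\|^2+\left\|\frac{\partial E_z}{\partial x}+\sigma H_y\right\|^2+\left\|\frac{\partial E_z}{\partial y}+\sigma H_x\right\|^2+\|\sigma H_y\|^2+\|\sigma H_x\|^2,$$ $$\mathcal{E}^{(1)}_\sigma(t)=\mathcal{E}^{(0)}_\sigma(t)+\int_{\Gamma_x}\gamma_y\sigma(x)\left(E_z(x,-y_0,t)^2+E_z(x,y_0,t)^2\right)dx+\int_0^t\Big[\gamma_y\int_{\Gamma_x}\Big(\frac{\partial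 E_z}{\partial t}(x,-y_0,t')^2+\frac{\partial E_z}{\partial t}(x,y_0,t')^2\Big)dx+\gamma_x\int_{\Gamma_y}\Big(\frac{\partial E_z}{\partial t}(x_0+\delta,y,t')^2+\frac{\partial E_z}{\partial t}(-x_0-\delta,y,t')^2\Big)dy\Big]dt'.$$ An inequality $\frac{d}{dt}\sqrt{\mathcal{E}}\le\sigma_\infty\sqrt{\mathcal{E}}$ is understood as $\frac{d}{dt}\mathcal{E}\le2\sigma_\infty\mathcal{E}$ (equivalent wherever $\mathcal{E}>0$). *)

(* Defs.v *)
From Stdlib Require Export Reals.
From Coquelicot Require Export Coquelicot.
Open Scope R_scope.

Definition Icc (L : R) (z : R) : Prop := - L <= z <= L.

Definition Rnneg (t : R) : Prop := 0 <= t.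

(** Derivatives relative to a set [A]: the usual derivative at interior points
    of [A], the one-sided derivative at an endpoint of an interval [A]. *)
Definition is_derive_on (A : R -> Prop) (f : R -> R) (x l : R) : Prop :=
  filterdiff f (within A (locally x)) (fun h : R => scal h l).

Definition ex_derive_on (A : R -> Prop) (f : R -> R) (x : R) : Prop :=
  exists l, is_derive_on A f x l.

(** Meaningful only where [ex_derive_on A f x] holds, like [Derive]. *)
Definition Derive_on (A : R -> Prop) (f : R -> R) (x : R) : R :=
  iota (is_derive_on A f x).

(** Everywhere below a field [f] is a function of [x], [y], [t] of which only
    the values on the space-time domain [-X <= x <= X], [-Y <= y <= Y],
    [0 <= t] matter. *)
Definition field := R -> R -> R -> R.

Definition Dx (X : R) (f : field) : field :=
  fun x y t => Derive_on (Icc X) (fun x' => f x' y t) x.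

Definition Dy (Y : R) (f : field) : field :=
  fun x y t => Derive_on (Icc Y) (fun y' => f x y' t) y.

Definition Dt (f : field) : field :=
  fun x y t => Derive_on Rnneg (fun t' => f x y t') t.

Definition dom (X Y : R) (p : R * R * R) : Prop :=
  Icc X (fst (fst p)) /\ Icc Y (snd (fst p)) /\ Rnneg (snd p).

(** [C0], [C1], [C2]: continuity, resp. continuous differentiability once and
    twice, up to the boundary of the space-time domain. *)
Definition C0 (X Y : R) (f : field) : Prop :=
  continuous_on (dom X Y)
    (fun p : R * R * R => f (fst (fst p)) (snd (fst p)) (snd p)).

Definition C1 (X Y : R) (f : field) : Prop :=
  C0 X Y f /\
  (forall x y t, Icc X x -> Icc Y y -> Rnneg t ->
     ex_derive_on (Icc X) (fun x' => f x' y t) x /\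
     ex_derive_on (Icc Y) (fun y' => f x y' t) y /\
     ex_derive_on Rnneg (fun t' => f x y t') t) /\
  C0 X Y (Dx X f) /\ C0 X Y (Dy Y f) /\ C0 X Y (Dt f).

Definition C2 (X Y : R) (f : field) : Prop :=
  C1 X Y f /\ C1 X Y (Dx X f) /\ C1 X Y (Dy Y f) /\ C1 X Y (Dt f).

Definition C1_on (L : R) (g : R -> R) : Prop :=
  (forall x, Icc L x -> ex_derive_on (Icc L) g x) /\
  continuous_on (Icc L) (Derive_on (Icc L) g).

(** Damping functions, for the layer [x0 <= |x| <= x0 + delta]. *)
Record damping (x0 delta : R) (sigma : R -> R) : Prop := {
  damping_C1 : C1_on (x0 + delta) sigma;
  damping_ge0 : forall x, Icc (x0 + delta) x -> 0 <= sigma x;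
  damping_eq0 : forall x, Rabs x <= x0 -> sigma x = 0
}.

Definition is_max_on (A : R -> Prop) (g : R -> R) (m : R) : Prop :=
  (exists x, A x /\ g x = m) /\ (forall x, A x -> g x <= m).

Record first_order_pml (X Y : R) (sigma : R -> R) (Ez Hy Hx Hxs : field)
    : Prop := {
  fo_Ez_smooth : C2 X Y Ez;
  fo_Hy_smooth : C1 X Y Hy;
  fo_Hx_smooth : C1 X Y Hx;
  fo_Hxs_smooth : C1 X Y Hxs;
  fo_Ez : forall x y t, Icc X x -> Icc Y y -> Rnneg t ->
    Dt Ez x y t =
      - Dx X Hy x y t + Dy Y Hx x y t + Hxs x y t - sigma x * Ez x y t;
  fo_Hy : forall x y t, Icc X x -> Icc Y y -> Rnneg t ->
    Dt Hy x y t = - Dx X Ez x y t - sigma x * Hy x y t;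
  fo_Hx : forall x y t, Icc X x -> Icc Y y -> Rnneg t ->
    Dt Hx x y t = Dy Y Ez x y t;
  fo_Hxs : forall x y t, Icc X x -> Icc Y y -> Rnneg t ->
    Dt Hxs x y t = sigma x * Dy Y Hx x y t
}.

Definition flux_x (X : R) (sigma : R -> R) (Ez Hy : field) : field :=
  fun x y t => Dx X Ez x y t + sigma x * Hy x y t.

Definition flux_y (Y : R) (sigma : R -> R) (Ez Hx : field) : field :=
  fun x y t => Dy Y Ez x y t + sigma x * Hx x y t.

Record second_order_pml (X Y : R) (sigma : R -> R) (Ez Hy Hx : field)
    : Prop := {
  so_Ez_smooth : C2 X Y Ez;
  so_Hy_smooth : C1 X Y Hy;
  so_Hx_smooth : C1 X Y Hx;
  so_Ez : forall x y t, Icc X x -> Icc Y y -> Rnneg t ->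
    Dt (Dt Ez) x y t + sigma x * Dt Ez x y t =
      Dx X (flux_x X sigma Ez Hy) x y t + Dy Y (flux_y Y sigma Ez Hx) x y t;
  so_Hy : forall x y t, Icc X x -> Icc Y y -> Rnneg t ->
    Dt Hy x y t = - Dx X Ez x y t - sigma x * Hy x y t;
  so_Hx : forall x y t, Icc X x -> Icc Y y -> Rnneg t ->
    Dt Hx x y t = Dy Y Ez x y t
}.

Definition impedance_bc (X Y gx gy : R) (Ez Hy Hx : field) : Prop :=
  (forall x t, Icc X x -> Rnneg t ->
     gy * Ez x Y t + Hx x Y t = 0 /\
     gy * Ez x (- Y) t - Hx x (- Y) t = 0) /\
  (forall y t, Icc Y y -> Rnneg t ->
     gx * Ez X y t - Hy X y t = 0 /\
     gx * Ez (- X) y t + Hy (- X) y t = 0).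

Definition implied_impedance_bc (X Y gx gy : R) (sigma : R -> R)
    (Ez Hy Hx : field) : Prop :=
  (forall x t, Icc X x -> Rnneg t ->
     gy * Dt Ez x Y t + sigma x * gy * Ez x Y t
       + flux_y Y sigma Ez Hx x Y t = 0 /\
     gy * Dt Ez x (- Y) t + sigma x * gy * Ez x (- Y) t
       - flux_y Y sigma Ez Hx x (- Y) t = 0) /\
  (forall y t, Icc Y y -> Rnneg t ->
     gx * Dt Ez X y t + flux_x X sigma Ez Hy X y t = 0 /\
     gx * Dt Ez (- X) y t - flux_x X sigma Ez Hy (- X) y t = 0).

Definition zero_bc (X Y : R) (f : field) : Prop :=
  (forall x t, Icc X x -> Rnneg t -> f x Y t = 0 /\ f x (- Y) t = 0) /\
  (forall y t, Icc Y y -> Rnneg t -> f X y t = 0 /\ f (- X) y t = 0).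

(** The [L^2] norm on the rectangle, as an iterated Riemann integral: it is only
    applied to functions that are continuous on the closed rectangle. *)
Definition L2norm (X Y : R) (u : R -> R -> R) : R :=
  sqrt (RInt (fun x => RInt (fun y => (u x y) ^ 2) (- Y) Y) (- X) X).

Definition energy0 (X Y : R) (sigma : R -> R) (Ez Hy Hx : field) (t : R) : R :=
  (L2norm X Y (fun x y => Dt Ez x y t)) ^ 2
  + (L2norm X Y (fun x y => Dx X Ez x y t + sigma x * Hy x y t)) ^ 2
  + (L2norm X Y (fun x y => Dy Y Ez x y t + sigma x * Hx x y t)) ^ 2
  + (L2norm X Y (fun x y => sigma x * Hy x y t)) ^ 2
  + (L2norm X Y (fun x y => sigma x * Hx x y t)) ^ 2.

Definition energy1 (X Y gx gy : R) (sigma : R -> R) (Ez Hy Hx : field) (t : R)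
    : R :=
  energy0 X Y sigma Ez Hy Hx t
  + RInt (fun x => gy * sigma x * ((Ez x (- Y) t) ^ 2 + (Ez x Y t) ^ 2)) (- X) X
  + RInt (fun t' =>
      gy * RInt (fun x => (Dt Ez x (- Y) t') ^ 2 + (Dt Ez x Y t') ^ 2) (- X) X
      + gx * RInt (fun y => (Dt Ez X y t') ^ 2 + (Dt Ez (- X) y t') ^ 2) (- Y) Y)
      0 t.

(** [d/dt sqrt e <= c * sqrt e] for all [t >= 0], in the form
    [d/dt e <= 2 * c * e], which also makes sense where [e] vanishes. *)
Definition sqrt_growth_le (e : R -> R) (c : R) : Prop :=
  forall t, Rnneg t -> exists l, is_derive_on Rnneg e t l /\ l <= 2 * c * e t.

(* Main.v *)
From Stdlib Require Import Lra ClassicalEpsilon.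
Require Import Defs.

(** The damped quantities are rearranged so that the system becomes a symmetric
    hyperbolic one with lower order terms.  Put [u = Dt Ez],
    [A = Dx Ez + sigma Hy], [B = Dy Ez + sigma Hx], [p = sigma Hy] and
    [q = sigma Hx].  The equations give
<<
      u_t = A_x + B_y - sigma u      A_t = u_x - sigma A
      B_t = u_y + sigma (B - q)      p_t = - sigma A      q_t = sigma (B - q)
>>
    and [energy0] is the integral of [u^2 + A^2 + B^2 + p^2 + q^2].  In its time
    derivative the first derivatives in space group into the divergence
    [2 (u A)_x + 2 (u B)_y], that is, into boundary integrals.  What remains is
    [2 sigma (- u^2 - A^2 + B^2 - p A - q^2)]: only [B^2] grows, the indefinite
    product [p A] is absorbed by [A^2 + p^2], and the sum is at most
    [2 sigma] times the energy density ([bulk_energy_rate], [energy0_rate]).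

    On the boundary, [Ez = 0] forces [u = 0], and the flux integrals vanish
    ([zero_bc_growth]).  The impedance condition at [x = -X, X] makes the outward
    flux [u A] equal to [- gx u^2]; at [y = -Y, Y] the outward flux [u B] is
    [- gy u^2 - gy sigma u Ez], where the last term is minus half of the time
    derivative of [gy sigma Ez^2].  The two extra terms of [energy1] are the
    boundary energy whose derivative cancels that term and the time integral of
    the dissipation, of which the flux supplies twice as much
    ([impedance_growth]).

    The first order system reduces to the second order one by differentiating the
    equation of [Ez] in time ([first_order_second_order]).  The magnetic fields
    are only [C1], so the exchange of mixed derivatives has to start from one of
    them alone: [Dt Hy] and [Dt Hx] are differentiable in space because the
    equations express them through differentiable fields, and
    [is_derive_on_swap] then yields the other mixed derivative.

    Since all derivatives are one-sided at the boundary, the calculus they need is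
    obtained from that on the whole line: the projection [c] of the line onto a
    closed interval turns a [C1] function [f] on the interval into the [C1]
    function [f (c z) + (z - c z) f' (c z)] on the line
    ([is_derive_proj_extension]). *)

(** * Derivatives and continuity relative to a set *)

(** Every filter limit of [within A (locally x)] is [x] itself because [x] lies in
    [A], so the quantification over limits in [filterdiff] collapses. *)
Lemma is_derive_on_eps (A : R -> Prop) (f : R -> R) (x l : R) :
  A x ->
  is_derive_on A f x l <->
  forall eps : posreal, exists d : posreal, forall y, A y ->
    Rabs (y - x) < d -> Rabs (f y - f x - (y - x) * l) <= eps * Rabs (y - x).
Proof.
  intros Ax; split.
  - intros [_ H] eps.
    assert (Hx : is_filter_lim (within A (locally x)) x)
      by (intros P HP; exact (filter_imp _ _ (fun y Py _ => Py) HP)).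
    destruct (H x Hx eps) as [d Hd]; exists d; intros y Ay Hy.
    exact (Hd y Hy Ay).
  - intros H; split.
    + apply (is_linear_scal_l (K := R_AbsRing) (V := R_NormedModule) l).
    + intros x' Hx'.
      assert (E : x = x').
      { apply eq_close; intros eps.
        assert (H0 : within A (locally x) (ball x' eps))
          by (apply Hx'; exists eps; auto).
        apply ball_sym; destruct H0 as [d Hd].
        exact (Hd x (ball_center x d) Ax). }
      subst x'; intros eps; destruct (H eps) as [d Hd]; exists d.
      intros y Hy Ay; exact (Hd y Ay Hy).
Qed.

Lemma continuous_on_eps (U : UniformSpace) (D : U -> Prop) (f : U -> R) :
  continuous_on D f <->
  forall x, D x -> forall eps : posreal, exists d : posreal,
    forall y, D y -> ball x d y -> Rabs (f y - f x) < eps.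
Proof.
  split.
  - intros H x Dx' eps.
    destruct (proj1 (filterlim_locally _ _) (H x Dx') eps) as [d Hd].
    exists d; intros y Dy' Hy; exact (Hd y Hy Dy').
  - intros H x Dx'; apply filterlim_locally; intros eps.
    destruct (H x Dx' eps) as [d Hd]; exists d; intros y Hy Dy'.
    exact (Hd y Dy' Hy).
Qed.

Lemma continuous_on_comp (U V W : UniformSpace) (D : U -> Prop)
    (D' : V -> Prop) (f : U -> V) (g : V -> W) :
  (forall u, D u -> D' (f u)) -> continuous_on D f -> continuous_on D' g ->
  continuous_on D (fun u => g (f u)).
Proof.
  intros HD Hf Hg u Du; specialize (Hf u Du); specialize (Hg (f u) (HD u Du)).
  intros P HP; specialize (Hg P HP).
  specialize (Hf _ Hg); unfold filtermap, within in *.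
  revert Hf; apply filter_imp; auto.
Qed.

Lemma continuous_on_pair (U V W : UniformSpace) (D : U -> Prop)
    (f : U -> V) (g : U -> W) :
  continuous_on D f -> continuous_on D g ->
  continuous_on D (fun u => (f u, g u)).
Proof.
  intros Hf Hg u Du.
  apply filterlim_locally; intros eps.
  apply filter_and.
  - exact (proj1 (filterlim_locally _ _) (Hf u Du) eps).
  - exact (proj1 (filterlim_locally _ _) (Hg u Du) eps).
Qed.

Lemma continuous_on_const (U V : UniformSpace) (D : U -> Prop) (k : V) :
  continuous_on D (fun _ => k).
Proof. apply continuous_on_forall; intros; apply continuous_const. Qed.

Lemma continuous_on_id (U : UniformSpace) (D : U -> Prop) :
  continuous_on D (fun u => u).
Proof. apply continuous_on_forall; intros; apply continuous_id. Qed.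

Lemma continuous_on_plus (U : UniformSpace) (D : U -> Prop) (f g : U -> R) :
  continuous_on D f -> continuous_on D g -> continuous_on D (fun u => f u + g u).
Proof.
  intros Hf Hg u Du; apply (filterlim_comp_2 f g Rplus (Hf u Du) (Hg u Du)).
  apply (filterlim_plus (K := R_AbsRing) (V := R_NormedModule) (f u) (g u)).
Qed.

Lemma continuous_on_mult (U : UniformSpace) (D : U -> Prop) (f g : U -> R) :
  continuous_on D f -> continuous_on D g -> continuous_on D (fun u => f u * g u).
Proof.
  intros Hf Hg u Du; apply (filterlim_comp_2 f g Rmult (Hf u Du) (Hg u Du)).
  apply (filterlim_mult (K := R_AbsRing) (f u) (g u)).
Qed.

Lemma continuous_on_opp (U : UniformSpace) (D : U -> Prop) (f : U -> R) :
  continuous_on D f -> continuous_on D (fun u => - f u).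
Proof.
  intros Hf; apply continuous_on_ext with (fun u => -1 * f u).
  { intros u _; change (-1 * f u = - f u); ring. }
  apply continuous_on_mult; [apply continuous_on_const|exact Hf].
Qed.

Lemma continuous_on_minus (U : UniformSpace) (D : U -> Prop) (f g : U -> R) :
  continuous_on D f -> continuous_on D g -> continuous_on D (fun u => f u - g u).
Proof.
  intros Hf Hg; apply continuous_on_plus; [exact Hf|apply continuous_on_opp, Hg].
Qed.

Lemma continuous_on_pow (U : UniformSpace) (D : U -> Prop) (f : U -> R) (n : nat) :
  continuous_on D f -> continuous_on D (fun u => f u ^ n).
Proof.
  intros Hf; induction n as [|n IH]; simpl.
  - apply continuous_on_const.
  - apply continuous_on_mult; assumption.
Qed.

(** Carathéodory's form of differentiability: the difference quotient extends
    continuously to [x].  The rules for sums and products become identities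
    between such extended quotients. *)
Lemma is_derive_on_slope (A : R -> Prop) (f : R -> R) (x l : R) :
  A x ->
  is_derive_on A f x l <->
  exists phi : R -> R, filterlim phi (within A (locally x)) (locally l) /\
    forall y, A y -> f y = f x + (y - x) * phi y.
Proof.
  intros Ax; rewrite is_derive_on_eps by exact Ax; split.
  - intros H.
    exists (fun y => if Req_EM_T y x then l else (f y - f x) / (y - x)); split.
    + apply filterlim_locally; intros eps.
      destruct (H (pos_div_2 eps)) as [d Hd]; exists d; intros y Hy Ay.
      specialize (Hd y Ay Hy); simpl in Hd.
      destruct (Req_EM_T y x) as [E|E]; [apply ball_center|].
      assert (P : 0 < Rabs (y - x)) by (apply Rabs_pos_lt; lra).
      change (Rabs ((f y - f x) / (y - x) - l) < eps).
      apply Rmult_lt_reg_r with (1 := P); rewrite <- Rabs_mult.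
      replace (((f y - f x) / (y - x) - l) * (y - x))
        with (f y - f x - (y - x) * l) by (field; lra).
      generalize (Rmult_lt_0_compat _ _ (cond_pos eps) P); lra.
    + intros y _; destruct (Req_EM_T y x) as [->|E]; [ring|field; lra].
  - intros [phi [Hphi E]] eps.
    destruct (proj1 (filterlim_locally _ _) Hphi eps) as [d Hd].
    exists d; intros y Ay Hy; rewrite (E y Ay).
    replace (f x + (y - x) * phi y - f x - (y - x) * l)
      with ((phi y - l) * (y - x)) by ring.
    rewrite Rabs_mult; apply Rmult_le_compat_r; [apply Rabs_pos|].
    apply Rlt_le; exact (Hd y Hy Ay).
Qed.

Lemma filterlim_within_id (A : R -> Prop) (x : R) :
  filterlim (fun y => y) (within A (locally x)) (locally x).
Proof. intros P HP; exact (filter_imp _ _ (fun y Py _ => Py) HP). Qed.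

Lemma filterlim_Rplus (T : Type) (F : (T -> Prop) -> Prop) (FF : Filter F)
    (f g : T -> R) (l m : R) :
  filterlim f F (locally l) -> filterlim g F (locally m) ->
  filterlim (fun x => f x + g x) F (locally (l + m)).
Proof.
  intros Hf Hg; apply (filterlim_comp_2 f g Rplus Hf Hg).
  apply (filterlim_plus (K := R_AbsRing) (V := R_NormedModule) l m).
Qed.

Lemma filterlim_Rmult (T : Type) (F : (T -> Prop) -> Prop) (FF : Filter F)
    (f g : T -> R) (l m : R) :
  filterlim f F (locally l) -> filterlim g F (locally m) ->
  filterlim (fun x => f x * g x) F (locally (l * m)).
Proof.
  intros Hf Hg; apply (filterlim_comp_2 f g Rmult Hf Hg).
  apply (filterlim_mult (K := R_AbsRing) l m).
Qed.

Lemma is_derive_on_filterlim (A : R -> Prop) (f : R -> R) (x l : R) :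
  A x -> is_derive_on A f x l ->
  filterlim f (within A (locally x)) (locally (f x)).
Proof.
  intros Ax H; destruct (proj1 (is_derive_on_slope A f x l Ax) H) as [phi [Hp E]].
  apply filterlim_within_ext with (fun y => f x + (y + - x) * phi y).
  { intros y Ay; symmetry; exact (E y Ay). }
  refine (eq_ind (f x + (x + - x) * l)
    (fun m => filterlim _ _ (locally m)) _ (f x) _); [|ring].
  apply filterlim_Rplus; [apply within_filter, locally_filter|apply filterlim_const|].
  apply filterlim_Rmult; [apply within_filter, locally_filter| |exact Hp].
  apply filterlim_Rplus;
    [apply within_filter, locally_filter|apply filterlim_within_id|apply filterlim_const].
Qed.

Lemma ex_derive_on_continuous_on (A : R -> Prop) (f : R -> R) :
  (forall x, A x -> ex_derive_on A f x) -> continuous_on A f.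
Proof.
  intros H x Ax; destruct (H x Ax) as [l Hl].
  exact (is_derive_on_filterlim A f x l Ax Hl).
Qed.

Lemma is_derive_on_ext (A : R -> Prop) (f g : R -> R) (x l : R) :
  A x -> (forall y, A y -> f y = g y) ->
  is_derive_on A f x l -> is_derive_on A g x l.
Proof.
  intros Ax E; rewrite !is_derive_on_slope by exact Ax.
  intros [phi [Hp H]]; exists phi; split; [exact Hp|].
  intros y Ay; rewrite <- !E by assumption; auto.
Qed.

Lemma is_derive_on_const (A : R -> Prop) (k x : R) :
  A x -> is_derive_on A (fun _ => k) x 0.
Proof.
  intros Ax; apply is_derive_on_slope; [exact Ax|].
  exists (fun _ => 0); split; [apply filterlim_const|intros; ring].
Qed.

Lemma is_derive_on_plus (A : R -> Prop) (f g : R -> R) (x l m : R) :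
  A x -> is_derive_on A f x l -> is_derive_on A g x m ->
  is_derive_on A (fun y => f y + g y) x (l + m).
Proof.
  intros Ax; rewrite !is_derive_on_slope by exact Ax.
  intros [p [Hp Ep]] [q [Hq Eq]]; exists (fun y => p y + q y); split.
  - apply filterlim_Rplus; [apply within_filter, locally_filter|exact Hp|exact Hq].
  - intros y Ay; rewrite (Ep y Ay), (Eq y Ay); ring.
Qed.

Lemma is_derive_on_mult (A : R -> Prop) (f g : R -> R) (x l m : R) :
  A x -> is_derive_on A f x l -> is_derive_on A g x m ->
  is_derive_on A (fun y => f y * g y) x (l * g x + f x * m).
Proof.
  intros Ax Hf Hg.
  assert (Hc := is_derive_on_filterlim A g x m Ax Hg).
  revert Hf Hg; rewrite !is_derive_on_slope by exact Ax.
  intros [p [Hp Ep]] [q [Hq Eq]].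
  exists (fun y => p y * g y + f x * q y); split.
  - apply filterlim_Rplus; [apply within_filter, locally_filter| |];
      apply filterlim_Rmult; try apply within_filter, locally_filter; try assumption.
    apply filterlim_const.
  - intros y Ay; rewrite (Ep y Ay), (Eq y Ay); ring.
Qed.

Lemma is_derive_on_scal (A : R -> Prop) (k : R) (f : R -> R) (x l : R) :
  A x -> is_derive_on A f x l -> is_derive_on A (fun y => k * f y) x (k * l).
Proof.
  intros Ax H; replace (k * l) with (0 * f x + k * l) by ring.
  apply is_derive_on_mult; [exact Ax|apply is_derive_on_const, Ax|exact H].
Qed.

Lemma is_derive_on_opp (A : R -> Prop) (f : R -> R) (x l : R) :
  A x -> is_derive_on A f x l -> is_derive_on A (fun y => - f y) x (- l).
Proof.
  intros Ax H; apply is_derive_on_ext with (fun y => -1 * f y); [exact Ax| |].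
  - intros; ring.
  - replace (- l) with (-1 * l) by ring; apply is_derive_on_scal; assumption.
Qed.

Lemma is_derive_on_minus (A : R -> Prop) (f g : R -> R) (x l m : R) :
  A x -> is_derive_on A f x l -> is_derive_on A g x m ->
  is_derive_on A (fun y => f y - g y) x (l - m).
Proof.
  intros Ax Hf Hg; apply is_derive_on_plus; [exact Ax|exact Hf|].
  apply is_derive_on_opp; assumption.
Qed.

Lemma is_derive_on_sqr (A : R -> Prop) (f : R -> R) (x l : R) :
  A x -> is_derive_on A f x l ->
  is_derive_on A (fun y => f y ^ 2) x (2 * f x * l).
Proof.
  intros Ax H; apply is_derive_on_ext with (fun y => f y * f y); [exact Ax| |].
  - intros; ring.
  - replace (2 * f x * l) with (l * f x + f x * l) by ring.
    apply is_derive_on_mult; assumption.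
Qed.

(** * Calculus on closed intervals *)

(** A closed nondegenerate interval, bounded or not, given through its nearest
    point projection [c]: the point [c y] separates [y] from every point of [A].
    This covers [Icc L] and [Rnneg] at once, and convexity and closedness both
    follow from it. *)
Record closed_interval (A : R -> Prop) (c : R -> R) : Prop := {
  proj_in : forall y, A (c y);
  proj_between : forall y s, A s -> y <= c y <= s \/ s <= c y <= y;
  two_points : exists a b, A a /\ A b /\ a < b
}.

Lemma Icc_interval (L : R) :
  0 < L -> closed_interval (Icc L) (fun y => Rmax (- L) (Rmin L y)).
Proof.
  intros HL; unfold Icc; split.
  - intros y; unfold Rmax, Rmin; destruct (Rle_dec L y); destruct (Rle_dec _ _); lra.
  - intros y s Hs; unfold Rmax, Rmin; destruct (Rle_dec L y); destruct (Rle_dec _ _); lra.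
  - exists (- L), L; lra.
Qed.

Lemma Rnneg_interval : closed_interval Rnneg (Rmax 0).
Proof.
  unfold Rnneg; split.
  - intros y; apply Rmax_l.
  - intros y s Hs; unfold Rmax; destruct (Rle_dec _ _); lra.
  - exists 0, 1; lra.
Qed.

Lemma proj_id (A : R -> Prop) (c : R -> R) (y : R) :
  closed_interval A c -> A y -> c y = y.
Proof. intros H Ay; destruct (proj_between A c H y y Ay); lra. Qed.

Lemma interval_convex (A : R -> Prop) (c : R -> R) (a b y : R) :
  closed_interval A c -> A a -> A b -> Rmin a b <= y <= Rmax a b -> A y.
Proof.
  intros H Aa Ab Hy.
  replace y with (c y); [apply (proj_in A c H)|].
  destruct (proj_between A c H y a Aa), (proj_between A c H y b Ab);
    revert Hy; unfold Rmin, Rmax; destruct (Rle_dec a b); lra.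
Qed.

Lemma proj_dist (A : R -> Prop) (c : R -> R) (y s : R) :
  closed_interval A c -> A s ->
  Rabs (c y - s) <= Rabs (y - s) /\ Rabs (y - c y) <= Rabs (y - s).
Proof.
  intros H As; destruct (proj_between A c H y s As);
    unfold Rabs; repeat destruct (Rcase_abs _); lra.
Qed.

Lemma proj_continuous (A : R -> Prop) (c : R -> R) :
  closed_interval A c -> forall y, continuous c y.
Proof.
  intros H y; apply filterlim_locally; intros eps; exists eps; intros z Hz.
  change (Rabs (z - y) < eps) in Hz; change (Rabs (c z - c y) < eps).
  eapply Rle_lt_trans; [|exact Hz].
  destruct (proj_between A c H y (c z) (proj_in A c H z)),
    (proj_between A c H z (c y) (proj_in A c H y));
    unfold Rabs; repeat destruct (Rcase_abs _); lra.
Qed.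

(** This is where closedness enters: a point outside [A] keeps a positive distance
    from its projection, which is an endpoint of [A]. *)
Lemma proj_locally_constant (A : R -> Prop) (c : R -> R) (y : R) :
  closed_interval A c -> ~ A y -> locally y (fun z => c z = c y).
Proof.
  intros H NA.
  assert (Hne : y <> c y) by (intros E; apply NA; rewrite E; apply (proj_in A c H)).
  assert (P : 0 < Rabs (y - c y)) by (apply Rabs_pos_lt; lra).
  exists (mkposreal _ P); intros z Hz.
  change (Rabs (z - y) < Rabs (y - c y)) in Hz.
  destruct (proj_between A c H y (c z) (proj_in A c H z)),
    (proj_between A c H z (c y) (proj_in A c H y));
    revert Hz; unfold Rabs; repeat destruct (Rcase_abs _); lra.
Qed.

Lemma continuous_proj (A : R -> Prop) (c : R -> R) (U : UniformSpace) (g : R -> U) :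
  closed_interval A c -> continuous_on A g -> forall y, continuous (fun z => g (c z)) y.
Proof.
  intros H Hg y.
  apply (continuous_continuous_on (fun _ => True)); [apply filter_true|].
  apply continuous_on_comp with A; [intros z _; apply (proj_in A c H)| |exact Hg].
  apply continuous_on_forall; intros z _; apply (proj_continuous A c H).
Qed.

(** A passage from the relative to the ordinary derivative, so that the latter can
    be checked with [is_derive_on_eps]. *)
Lemma is_derive_on_full (f : R -> R) (x l : R) :
  is_derive_on (fun _ => True) f x l -> is_derive f x l.
Proof.
  intros [Hl H]; split; [exact Hl|]; intros x' Hx' eps.
  assert (Hw : is_filter_lim (within (fun _ => True) (locally x)) x')
    by (intros P HP; exact (filter_imp _ _ (fun y Py _ => Py) (Hx' P HP))).
  exact (filter_imp _ _ (fun y Py => Py I) (H x' Hw eps)).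
Qed.

Lemma is_derive_is_derive_on (A : R -> Prop) (f : R -> R) (x l : R) :
  A x -> is_derive f x l -> is_derive_on A f x l.
Proof.
  intros Ax H.
  apply (@filterdiff_locally R_AbsRing R_NormedModule R_NormedModule
           (within A (locally x))) with x; [|exact (filterlim_within_id A x)|exact H].
  constructor; [|apply within_filter, locally_filter].
  intros P [d Hd]; exists x; apply Hd; [apply ball_center|exact Ax].
Qed.

(** Beyond an endpoint the extension is affine with the one-sided slope.  At a
    point [y] of [A] the increment splits into the increment of [f] from [y] to
    [c z], where differentiability on [A] applies, and the affine piece from [c z]
    to [z], whose slope is close to [g y] by continuity of [g]; both pieces are no
    longer than [z - y]. *)
Lemma is_derive_proj_extension (A : R -> Prop) (c : R -> R) (f g : R -> R) :
  closed_interval A c ->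
  (forall x, A x -> is_derive_on A f x (g x)) -> continuous_on A g ->
  forall y, is_derive (fun z => f (c z) + (z - c z) * g (c z)) y (g (c y)).
Proof.
  intros H Hd Hg y; destruct (classic (A y)) as [Ay|Ny].
  - apply is_derive_on_full, is_derive_on_eps; [exact I|]; intros eps.
    rewrite (proj_id A c y H Ay).
    destruct (proj1 (is_derive_on_eps A f y (g y) Ay) (Hd y Ay) (pos_div_2 eps))
      as [d1 H1].
    destruct (proj1 (continuous_on_eps _ A g) Hg y Ay (pos_div_2 eps)) as [d2 H2].
    exists (mkposreal _ (Rmin_pos _ _ (cond_pos d1) (cond_pos d2))); simpl.
    intros z _ Hz; destruct (proj_dist A c z y H Ay) as [D1 D2].
    specialize (H1 (c z) (proj_in A c H z)
      (Rle_lt_trans _ _ _ D1 (Rlt_le_trans _ _ _ Hz (Rmin_l _ _)))).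
    specialize (H2 (c z) (proj_in A c H z)
      (Rle_lt_trans _ _ _ D1 (Rlt_le_trans _ _ _ Hz (Rmin_r _ _)))).
    simpl in H1, H2.
    replace (f (c z) + (z - c z) * g (c z) - (f y + (y - y) * g y) - (z - y) * g y)
      with ((f (c z) - f y - (c z - y) * g y) + (z - c z) * (g (c z) - g y)) by ring.
    eapply Rle_trans; [apply Rabs_triang|]; rewrite Rabs_mult.
    assert (Hm := Rmult_le_compat _ _ _ _ (Rabs_pos (z - c z)) (Rabs_pos _) D2
                    (Rlt_le _ _ H2)).
    assert (Hn := Rmult_le_compat_l (eps / 2) _ _
                    (Rlt_le _ _ (cond_pos (pos_div_2 eps))) D1).
    lra.
  - assert (E := proj_locally_constant A c y H Ny).
    apply is_derive_ext_loc with (fun z => f (c y) + (z - c y) * g (c y)).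
    + revert E; apply filter_imp; intros z Ez; rewrite Ez; reflexivity.
    + auto_derive; [exact I|ring].
Qed.

Lemma continuous_on_ex_RInt (A : R -> Prop) (c : R -> R) (f : R -> R) (a b : R) :
  closed_interval A c -> continuous_on A f -> A a -> A b -> ex_RInt f a b.
Proof.
  intros H Hf Aa Ab; apply ex_RInt_ext with (fun z => f (c z)).
  - intros z Hz; rewrite (proj_id A c z H); [reflexivity|].
    apply (interval_convex A c a b z H Aa Ab); lra.
  - apply (ex_RInt_continuous (V := R_CompleteNormedModule)); intros z _.
    apply (continuous_proj A c _ f H Hf).
Qed.

Lemma is_RInt_derive_on (A : R -> Prop) (c : R -> R) (f g : R -> R) (a b : R) :
  closed_interval A c ->
  (forall x, A x -> is_derive_on A f x (g x)) -> continuous_on A g ->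
  A a -> A b -> is_RInt g a b (f b - f a).
Proof.
  intros H Hd Hg Aa Ab.
  apply is_RInt_ext with (fun z => g (c z)).
  { intros z Hz; rewrite (proj_id A c z H); [reflexivity|].
    apply (interval_convex A c a b z H Aa Ab); lra. }
  assert (HI := is_RInt_derive (V := R_CompleteNormedModule)
    (fun z => f (c z) + (z - c z) * g (c z)) (fun z => g (c z)) a b
    (fun z _ => is_derive_proj_extension A c f g H Hd Hg z)
    (fun z _ => continuous_proj A c _ g H Hg z)).
  cbv beta in HI; rewrite (proj_id A c a H Aa), (proj_id A c b H Ab) in HI.
  replace (f b - f a) with
    (minus (f b + (b - b) * g b) (f a + (a - a) * g a)) by
    (unfold minus, plus, opp; simpl; ring).
  exact HI.
Qed.

Lemma mean_value_on (A : R -> Prop) (c : R -> R) (f g : R -> R) (a b : R) :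
  closed_interval A c ->
  (forall x, A x -> is_derive_on A f x (g x)) -> continuous_on A g ->
  A a -> A b ->
  exists z, Rmin a b <= z <= Rmax a b /\ f b - f a = g z * (b - a).
Proof.
  intros H Hd Hg Aa Ab.
  assert (He := is_derive_proj_extension A c f g H Hd Hg).
  destruct (MVT_gen (fun z => f (c z) + (z - c z) * g (c z)) a b (fun z => g (c z)))
    as [z [Hz E]].
  - intros x _; apply He.
  - intros x _; apply continuity_pt_filterlim.
    exact (ex_derive_continuous (V := R_NormedModule) _ x
             (ex_intro _ (g (c x)) (He x))).
  - exists z; split; [exact Hz|].
    rewrite (proj_id A c a H Aa), (proj_id A c b H Ab),
      (proj_id A c z H (interval_convex A c a b z H Aa Ab Hz)) in E; lra.
Qed.

Lemma is_derive_on_RInt_upper (A : R -> Prop) (c : R -> R) (g : R -> R) (a x : R) :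
  closed_interval A c -> continuous_on A g -> A a -> A x ->
  is_derive_on A (fun y => RInt g a y) x (g x).
Proof.
  intros H Hg Aa Ax.
  apply is_derive_on_ext with (fun y => RInt (fun z => g (c z)) a y); [exact Ax| |].
  - intros y Ay; apply RInt_ext; intros z Hz; rewrite (proj_id A c z H); [reflexivity|].
    apply (interval_convex A c a y z H Aa Ay); lra.
  - apply is_derive_is_derive_on; [exact Ax|].
    replace (g x) with (g (c x)) by (rewrite (proj_id A c x H Ax); reflexivity).
    assert (Hc := continuous_proj A c _ g H Hg).
    apply (is_derive_RInt (V := R_NormedModule) (fun z => g (c z)) _ a x); [|apply Hc].
    apply filter_forall; intros y.
    apply (RInt_correct (V := R_CompleteNormedModule)).
    apply (ex_RInt_continuous (V := R_CompleteNormedModule)); intros z _; apply Hc.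
Qed.

(** Uniqueness needs points of [A] other than [x] arbitrarily close to [x], which
    [two_points] and convexity provide. *)
Lemma is_derive_on_unique (A : R -> Prop) (c : R -> R) (f : R -> R) (x l m : R) :
  closed_interval A c -> A x ->
  is_derive_on A f x l -> is_derive_on A f x m -> l = m.
Proof.
  intros H Ax Hl Hm; apply eq_close; intros eps.
  destruct (proj1 (is_derive_on_eps A f x l Ax) Hl (pos_div_2 (pos_div_2 eps)))
    as [d1 H1].
  destruct (proj1 (is_derive_on_eps A f x m Ax) Hm (pos_div_2 (pos_div_2 eps)))
    as [d2 H2].
  assert (Hd : 0 < Rmin d1 d2) by (apply Rmin_pos; apply cond_pos).
  assert (Hy : exists y, A y /\ y <> x /\ Rabs (y - x) < Rmin d1 d2).
  { destruct (two_points A c H) as [a [b [Aa [Ab Hab]]]].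
    revert Hd; generalize (Rmin d1 d2); intros e Hd.
    destruct (Rlt_le_dec x b) as [Hx|Hx].
    - exists (Rmin b (x + e / 2)).
      assert (Hb : x < Rmin b (x + e / 2) <= b /\ Rmin b (x + e / 2) < x + e)
        by (unfold Rmin; destruct (Rle_dec b _); lra).
      revert Hb; generalize (Rmin b (x + e / 2)); intros y Hb.
      split; [|split; [lra|rewrite Rabs_pos_eq; lra]].
      apply (interval_convex A c x b); [exact H|exact Ax|exact Ab|].
      rewrite Rmin_left, Rmax_right; lra.
    - exists (Rmax a (x - e / 2)).
      assert (Hb : a <= Rmax a (x - e / 2) < x /\ x - e < Rmax a (x - e / 2))
        by (unfold Rmax; destruct (Rle_dec a _); lra).
      revert Hb; generalize (Rmax a (x - e / 2)); intros y Hb.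
      split; [|split; [lra|rewrite Rabs_left1; lra]].
      apply (interval_convex A c a x); [exact H|exact Aa|exact Ax|].
      rewrite Rmin_left, Rmax_right; lra. }
  destruct Hy as [y [Ay [Ny Hy]]].
  specialize (H1 y Ay (Rlt_le_trans _ _ _ Hy (Rmin_l _ _))).
  specialize (H2 y Ay (Rlt_le_trans _ _ _ Hy (Rmin_r _ _))); simpl in H1, H2.
  assert (P : 0 < Rabs (y - x)) by (apply Rabs_pos_lt; lra).
  change (Rabs (m - l) < eps).
  apply Rmult_lt_reg_r with (1 := P); rewrite <- Rabs_mult.
  replace ((m - l) * (y - x)) with
    ((f y - f x - (y - x) * l) - (f y - f x - (y - x) * m)) by ring.
  eapply Rle_lt_trans; [apply Rabs_triang|]; rewrite Rabs_Ropp.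
  generalize (Rmult_lt_0_compat _ _ (cond_pos eps) P); lra.
Qed.

Lemma Derive_on_unique (A : R -> Prop) (c : R -> R) (f : R -> R) (x l : R) :
  closed_interval A c -> A x -> is_derive_on A f x l -> Derive_on A f x = l.
Proof.
  intros H Ax Hl.
  apply (iota_unique (K := R_AbsRing) (V := R_CompleteNormedModule)); [|exact Hl].
  intros m Hm; exact (is_derive_on_unique A c f x m l H Ax Hm Hl).
Qed.

Lemma Derive_on_correct (A : R -> Prop) (c : R -> R) (f : R -> R) (x : R) :
  closed_interval A c -> A x -> ex_derive_on A f x ->
  is_derive_on A f x (Derive_on A f x).
Proof.
  intros H Ax [l Hl]; rewrite (Derive_on_unique A c f x l H Ax Hl); exact Hl.
Qed.

(** * Integrals depending on a parameter *)

Definition prod_set (U : Type) (D : U -> Prop) (B : R -> Prop) (p : U * R) : Prop :=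
  D (fst p) /\ B (snd p).

(** Uniform continuity of [f] near the compact slice over [u0]: finitely many of
    the neighbourhoods given by continuity at points between [a] and [b] suffice. *)
Lemma uniformly_close_slices (U : UniformSpace) (D : U -> Prop) (B : R -> Prop)
    (c : R -> R) (f : U -> R -> R) (u0 : U) (a b : R) (eps : posreal) :
  closed_interval B c ->
  continuous_on (prod_set U D B) (fun p => f (fst p) (snd p)) ->
  D u0 -> B a -> B b -> a <= b ->
  exists d : posreal, forall u y, D u -> ball u0 d u -> a <= y <= b ->
    Rabs (f u y - f u0 y) < eps.
Proof.
  intros H Hf Du Ba Bb Hab.
  assert (HB : forall y, a <= y <= b -> B y).
  { intros y Hy; apply (interval_convex B c a b y H Ba Bb).
    rewrite Rmin_left, Rmax_right; lra. }
  assert (Hloc : forall y, exists d : posreal, a <= y <= b ->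
      forall u z, D u -> B z -> ball u0 d u -> Rabs (z - y) < d ->
      Rabs (f u z - f u0 y) < eps / 2).
  { intros y; destruct (classic (a <= y <= b)) as [Hy|Hy];
      [|exists eps; intros; contradiction].
    destruct (proj1 (continuous_on_eps _ _ _) Hf (u0, y) (conj Du (HB y Hy))
                (pos_div_2 eps)) as [d Hd].
    exists d; intros _ u z Du' Bz Bu Bzy.
    exact (Hd (u, z) (conj Du' Bz) (conj Bu Bzy)). }
  destruct (compactness_value_1d a b
    (fun y => proj1_sig (constructive_indefinite_description _ (Hloc y)))) as [d Hd].
  exists d; intros u y Du' Bu Hy.
  apply NNPP; intros N; apply (Hd y Hy); intros [t [Ht [Hyt Hdt]]]; apply N.
  revert Hyt Hdt; destruct (constructive_indefinite_description _ (Hloc t)) as [e He].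
  simpl; intros Hyt Hde; specialize (He Ht).
  assert (H1 := He u y Du' (HB y Hy) (ball_le u0 d e Hde u Bu) Hyt).
  assert (H2 := He u0 y Du (HB y Hy) (ball_center u0 e) Hyt).
  replace (f u y - f u0 y) with ((f u y - f u0 t) - (f u0 y - f u0 t)) by ring.
  eapply Rle_lt_trans; [apply Rabs_triang|]; rewrite Rabs_Ropp; lra.
Qed.

Lemma continuous_on_slice (U : UniformSpace) (D : U -> Prop) (B : R -> Prop)
    (f : U -> R -> R) (u : U) :
  continuous_on (prod_set U D B) (fun p => f (fst p) (snd p)) -> D u ->
  continuous_on B (f u).
Proof.
  intros Hf Du.
  apply (continuous_on_comp _ _ _ B (prod_set U D B) (fun y => (u, y))
           (fun p => f (fst p) (snd p))); [intros y By; split; assumption| |exact Hf].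
  apply continuous_on_pair; [apply continuous_on_const|apply continuous_on_id].
Qed.

Lemma continuous_on_RInt_param (U : UniformSpace) (D : U -> Prop)
    (B : R -> Prop) (c : R -> R) (f : U -> R -> R) (a b : R) :
  closed_interval B c ->
  continuous_on (prod_set U D B) (fun p => f (fst p) (snd p)) ->
  B a -> B b -> a <= b ->
  continuous_on D (fun u => RInt (f u) a b).
Proof.
  intros H Hf Ba Bb Hab; apply continuous_on_eps; intros u Du eps.
  (* The denominator b - a + 1 is positive even if a = b. *)
  assert (He : 0 < eps / (b - a + 1))
    by (apply Rdiv_lt_0_compat; [apply cond_pos|lra]).
  destruct (uniformly_close_slices U D B c f u a b (mkposreal _ He) H Hf Du Ba Bb Hab)
    as [d Hd]; simpl in Hd.
  exists d; intros v Dv Hv.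
  assert (Iv : ex_RInt (f v) a b) by
    (apply (continuous_on_ex_RInt B c); auto; apply (continuous_on_slice U D B); auto).
  assert (Iu : ex_RInt (f u) a b) by
    (apply (continuous_on_ex_RInt B c); auto; apply (continuous_on_slice U D B); auto).
  change (RInt (f v) a b - RInt (f u) a b) with (minus (RInt (f v) a b) (RInt (f u) a b)).
  rewrite <- (RInt_minus (V := R_CompleteNormedModule)) by assumption.
  eapply Rle_lt_trans.
  - apply (abs_RInt_le_const _ a b (eps / (b - a + 1)) Hab).
    + apply (ex_RInt_minus (V := R_NormedModule)); assumption.
    + intros y Hy; apply Rlt_le; exact (Hd v y Dv Hv Hy).
  - apply Rmult_lt_reg_r with (b - a + 1); [lra|].
    replace ((b - a) * (eps / (b - a + 1)) * (b - a + 1)) with ((b - a) * eps)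
      by (field; lra).
    generalize (cond_pos eps); lra.
Qed.

(** By the mean value theorem in [s], the increment quotient of [f] in the parameter
    is a value of [g] at a nearby parameter, hence uniformly close to [g s] over
    the compact range of integration. *)
Lemma is_derive_on_RInt_param (A B : R -> Prop) (c c' : R -> R)
    (f g : R -> R -> R) (a b : R) :
  closed_interval A c -> closed_interval B c' ->
  (forall s y, A s -> B y -> is_derive_on A (fun r => f r y) s (g s y)) ->
  (forall s, A s -> continuous_on B (f s)) ->
  continuous_on (prod_set R A B) (fun p => g (fst p) (snd p)) ->
  B a -> B b -> a <= b ->
  forall s, A s ->
    is_derive_on A (fun r => RInt (f r) a b) s (RInt (g s) a b).
Proof.
  intros HA HB Hd Hf Hg Ba Bb Hab s As.
  apply is_derive_on_eps; [exact As|]; intros eps.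
  assert (He : 0 < eps / (b - a + 1))
    by (apply Rdiv_lt_0_compat; [apply cond_pos|lra]).
  destruct (uniformly_close_slices R_UniformSpace A B c' g s a b (mkposreal _ He)
    HB Hg As Ba Bb Hab) as [d Hu]; simpl in Hu.
  exists d; intros r Ar Hr.
  assert (If : forall q, A q -> ex_RInt (f q) a b)
    by (intros q Aq; apply (continuous_on_ex_RInt B c'); auto).
  assert (Ig : ex_RInt (g s) a b) by
    (apply (continuous_on_ex_RInt B c'); auto;
     apply (continuous_on_slice R_UniformSpace A B); auto).
  assert (Id : ex_RInt (fun y =>
    minus (minus (f r y) (f s y)) (scal (r - s) (g s y))) a b).
  { apply (ex_RInt_minus (V := R_NormedModule)).
    - apply (ex_RInt_minus (V := R_NormedModule)); auto.
    - apply (ex_RInt_scal (V := R_NormedModule)); auto. }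
  assert (E : RInt (f r) a b - RInt (f s) a b - (r - s) * RInt (g s) a b =
    RInt (fun y => minus (minus (f r y) (f s y)) (scal (r - s) (g s y))) a b).
  { rewrite (RInt_minus (V := R_CompleteNormedModule)),
      (RInt_minus (V := R_CompleteNormedModule)),
      (RInt_scal (V := R_CompleteNormedModule)); auto.
    - apply (ex_RInt_minus (V := R_NormedModule)); auto.
    - apply (ex_RInt_scal (V := R_NormedModule)); auto. }
  rewrite E; eapply Rle_trans.
  - apply (abs_RInt_le_const _ a b (eps / (b - a + 1) * Rabs (r - s)) Hab Id).
    intros y Hy.
    assert (By : B y) by (apply (interval_convex B c' a b y HB Ba Bb);
      rewrite Rmin_left, Rmax_right; lra).
    assert (Hgy : continuous_on A (fun q => g q y)).
    { apply (continuous_on_comp _ _ _ A (prod_set R A B) (fun q => (q, y))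
           (fun p => g (fst p) (snd p))); [intros q Aq; split; assumption| |exact Hg].
      apply continuous_on_pair; [apply continuous_on_id|apply continuous_on_const]. }
    destruct (mean_value_on A c (fun q => f q y) (fun q => g q y) s r HA
      (fun q Aq => Hd q y Aq By) Hgy As Ar) as [z [Hz Ez]].
    assert (Az := interval_convex A c s r z HA As Ar Hz).
    assert (Hzd : Rabs (z - s) < d).
    { eapply Rle_lt_trans; [|exact Hr]; revert Hz.
      unfold Rmin, Rmax, Rabs; destruct (Rle_dec s r);
        repeat destruct (Rcase_abs _); lra. }
    change (Rabs (f r y - f s y - (r - s) * g s y)
              <= eps / (b - a + 1) * Rabs (r - s)).
    rewrite Ez; replace (g z y * (r - s) - (r - s) * g s y)
      with ((g z y - g s y) * (r - s)) by ring.
    rewrite Rabs_mult; apply Rmult_le_compat_r; [apply Rabs_pos|].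
    apply Rlt_le; exact (Hu z y Az Hzd Hy).
  - rewrite <- Rmult_assoc; apply Rmult_le_compat_r; [apply Rabs_pos|].
    apply Rmult_le_reg_r with (b - a + 1); [lra|].
    replace ((b - a) * (eps / (b - a + 1)) * (b - a + 1)) with ((b - a) * eps)
      by (field; lra).
    generalize (cond_pos eps); lra.
Qed.

(** Schwarz's theorem from a single continuous mixed derivative [fts].  Write
    [f s t] as [f s t0] plus the integral of [ft] from [t0] to [t] and differentiate
    under the integral sign in [s]; this exhibits [fs s t] as [fs s t0] plus an
    integral of [fts], whose derivative in [t] is read off. *)
Lemma is_derive_on_swap (A B : R -> Prop) (c c' : R -> R)
    (f fs ft fts : R -> R -> R) (t0 : R) :
  closed_interval A c -> closed_interval B c' ->
  B t0 -> (forall t, B t -> t0 <= t) ->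
  (forall s t, A s -> B t -> is_derive_on A (fun r => f r t) s (fs s t)) ->
  (forall s t, A s -> B t -> is_derive_on B (f s) t (ft s t)) ->
  (forall s t, A s -> B t -> is_derive_on A (fun r => ft r t) s (fts s t)) ->
  (forall s, A s -> continuous_on B (ft s)) ->
  continuous_on (prod_set R A B) (fun p => fts (fst p) (snd p)) ->
  forall s t, A s -> B t -> is_derive_on B (fs s) t (fts s t).
Proof.
  intros HA HB B0 Hmin Hs Ht Hts Cft Cfts s t As Bt.
  (* Both sides are derivatives at s of r |-> f r t', and such derivatives are unique. *)
  assert (E : forall t', B t' -> fs s t' = fs s t0 + RInt (fts s) t0 t').
  { intros t' Bt'.
    apply (is_derive_on_unique A c (fun r => f r t') s); [exact HA|exact As|auto|].
    apply is_derive_on_ext with (fun r => f r t0 + RInt (ft r) t0 t'); [exact As| |].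
    - intros r Ar.
      rewrite (is_RInt_unique (V := R_CompleteNormedModule) _ _ _ _
        (is_RInt_derive_on B c' (f r) (ft r) t0 t' HB (fun q Bq => Ht r q Ar Bq)
           (Cft r Ar) B0 Bt')); ring.
    - apply is_derive_on_plus; [exact As|auto|].
      apply (is_derive_on_RInt_param A B c c' ft fts); auto. }
  apply is_derive_on_ext with (fun t' => fs s t0 + RInt (fts s) t0 t'); [exact Bt| |].
  - intros t' Bt'; symmetry; auto.
  - replace (fts s t) with (0 + fts s t) by ring.
    apply is_derive_on_plus; [exact Bt|apply is_derive_on_const, Bt|].
    apply (is_derive_on_RInt_upper B c'); auto.
    apply (continuous_on_slice R_UniformSpace A B); auto.
Qed.

(** * Continuous fields *)

Lemma continuous_on_fst (U V : UniformSpace) (D : U * V -> Prop) :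
  continuous_on D (fun p : U * V => fst p).
Proof. apply continuous_on_forall; intros; apply continuous_fst. Qed.

Lemma continuous_on_snd (U V : UniformSpace) (D : U * V -> Prop) :
  continuous_on D (fun p : U * V => snd p).
Proof. apply continuous_on_forall; intros; apply continuous_snd. Qed.

(** Restriction of a field to a line, a face or any other parametrized part of the
    domain. *)
Lemma C0_along (U : UniformSpace) (D : U -> Prop) (X Y : R) (f : field)
    (a b c : U -> R) :
  C0 X Y f ->
  (forall u, D u -> Icc X (a u) /\ Icc Y (b u) /\ Rnneg (c u)) ->
  continuous_on D a -> continuous_on D b -> continuous_on D c ->
  continuous_on D (fun u => f (a u) (b u) (c u)).
Proof.
  intros Hf HD Ha Hb Hc.
  apply (continuous_on_comp _ _ _ D (dom X Y) (fun u => (a u, b u, c u))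
    (fun p : R * R * R => f (fst (fst p)) (snd (fst p)) (snd p))); [exact HD| |exact Hf].
  apply continuous_on_pair; [apply continuous_on_pair|]; assumption.
Qed.

Lemma C0_const (X Y k : R) : C0 X Y (fun _ _ _ => k).
Proof. exact (continuous_on_const _ R_UniformSpace (dom X Y) k). Qed.

Lemma C0_of_x (X Y : R) (g : R -> R) :
  continuous_on (Icc X) g -> C0 X Y (fun x _ _ => g x).
Proof.
  intros Hg.
  apply (continuous_on_comp _ _ _ (dom X Y) (Icc X)
    (fun p : R * R * R => fst (fst p)) g); [intros p Hp; apply Hp| |exact Hg].
  apply continuous_on_forall; intros p _.
  apply (continuous_comp fst fst); apply continuous_fst.
Qed.

Lemma C0_plus (X Y : R) (f g : field) :
  C0 X Y f -> C0 X Y g -> C0 X Y (fun x y t => f x y t + g x y t).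
Proof. apply continuous_on_plus. Qed.

Lemma C0_minus (X Y : R) (f g : field) :
  C0 X Y f -> C0 X Y g -> C0 X Y (fun x y t => f x y t - g x y t).
Proof. apply continuous_on_minus. Qed.

Lemma C0_mult (X Y : R) (f g : field) :
  C0 X Y f -> C0 X Y g -> C0 X Y (fun x y t => f x y t * g x y t).
Proof. apply continuous_on_mult. Qed.

Lemma C0_opp (X Y : R) (f : field) :
  C0 X Y f -> C0 X Y (fun x y t => - f x y t).
Proof. apply continuous_on_opp. Qed.

Lemma C0_pow (X Y : R) (f : field) (n : nat) :
  C0 X Y f -> C0 X Y (fun x y t => f x y t ^ n).
Proof. apply continuous_on_pow. Qed.

Lemma C0_ext (X Y : R) (f g : field) :
  (forall x y t, Icc X x -> Icc Y y -> Rnneg t -> f x y t = g x y t) ->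
  C0 X Y f -> C0 X Y g.
Proof.
  intros E; apply continuous_on_ext; intros [[x y] t] [Dx' [Dy' Dt']]; simpl in *; auto.
Qed.

Create HintDb C0.
#[local] Hint Resolve C0_const C0_plus C0_minus C0_mult C0_opp C0_pow : C0.

Lemma Icc_end (L : R) : 0 < L -> Icc L L /\ Icc L (- L).
Proof. unfold Icc; lra. Qed.

Lemma C0_slice_t (X Y : R) (f : field) (x y : R) :
  C0 X Y f -> Icc X x -> Icc Y y -> continuous_on Rnneg (fun t => f x y t).
Proof.
  intros Hf Hx Hy; apply (C0_along _ _ X Y f (fun _ => x) (fun _ => y) (fun t => t));
    auto using continuous_on_const, continuous_on_id.
Qed.

Lemma C0_slice_x (X Y : R) (f : field) (y t : R) :
  C0 X Y f -> Icc Y y -> Rnneg t -> continuous_on (Icc X) (fun x => f x y t).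
Proof.
  intros Hf Hy Ht; apply (C0_along _ _ X Y f (fun x => x) (fun _ => y) (fun _ => t));
    auto using continuous_on_const, continuous_on_id.
Qed.

Lemma C0_slice_y (X Y : R) (f : field) (x t : R) :
  C0 X Y f -> Icc X x -> Rnneg t -> continuous_on (Icc Y) (fun y => f x y t).
Proof.
  intros Hf Hx Ht; apply (C0_along _ _ X Y f (fun _ => x) (fun y => y) (fun _ => t));
    auto using continuous_on_const, continuous_on_id.
Qed.

Lemma C0_slice_tx (X Y : R) (f : field) (y : R) :
  C0 X Y f -> Icc Y y ->
  continuous_on (prod_set R Rnneg (Icc X)) (fun p => f (snd p) y (fst p)).
Proof.
  intros Hf Hy; apply (C0_along (prod_UniformSpace R_UniformSpace R_UniformSpace)
    _ X Y f (fun p => snd p) (fun _ => y) (fun p => fst p) Hf);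
    [intros p [H1 H2]; auto|..];
    auto using continuous_on_const, continuous_on_fst, continuous_on_snd.
Qed.

Lemma C0_slice_ty (X Y : R) (f : field) (x : R) :
  C0 X Y f -> Icc X x ->
  continuous_on (prod_set R Rnneg (Icc Y)) (fun p => f x (snd p) (fst p)).
Proof.
  intros Hf Hy; apply (C0_along (prod_UniformSpace R_UniformSpace R_UniformSpace)
    _ X Y f (fun _ => x) (fun p => snd p) (fun p => fst p) Hf);
    [intros p [H1 H2]; auto|..];
    auto using continuous_on_const, continuous_on_fst, continuous_on_snd.
Qed.

Lemma C0_slice_xt (X Y : R) (f : field) (y : R) :
  C0 X Y f -> Icc Y y ->
  continuous_on (prod_set R (Icc X) Rnneg) (fun p => f (fst p) y (snd p)).
Proof.
  intros Hf Hy; apply (C0_along (prod_UniformSpace R_UniformSpace R_UniformSpace)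
    _ X Y f (fun p => fst p) (fun _ => y) (fun p => snd p) Hf);
    [intros p [H1 H2]; auto|..];
    auto using continuous_on_const, continuous_on_fst, continuous_on_snd.
Qed.

Lemma C0_slice_yt (X Y : R) (f : field) (x : R) :
  C0 X Y f -> Icc X x ->
  continuous_on (prod_set R (Icc Y) Rnneg) (fun p => f x (fst p) (snd p)).
Proof.
  intros Hf Hy; apply (C0_along (prod_UniformSpace R_UniformSpace R_UniformSpace)
    _ X Y f (fun _ => x) (fun p => fst p) (fun p => snd p) Hf);
    [intros p [H1 H2]; auto|..];
    auto using continuous_on_const, continuous_on_fst, continuous_on_snd.
Qed.

Lemma C0_slice_xy (X Y : R) (f : field) (t : R) :
  C0 X Y f -> Rnneg t ->
  continuous_on (prod_set R (Icc X) (Icc Y)) (fun p => f (fst p) (snd p) t).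
Proof.
  intros Hf Ht; apply (C0_along (prod_UniformSpace R_UniformSpace R_UniformSpace)
    _ X Y f (fun p => fst p) (fun p => snd p) (fun _ => t) Hf);
    [intros p [H1 H2]; auto|..];
    auto using continuous_on_const, continuous_on_fst, continuous_on_snd.
Qed.

(** * Integrals over the rectangle *)

Definition rect_int (X Y : R) (f : field) (t : R) : R :=
  RInt (fun x => RInt (fun y => f x y t) (- Y) Y) (- X) X.

Lemma C0_y_integral (X Y : R) (f : field) :
  0 < Y -> C0 X Y f ->
  continuous_on (prod_set R Rnneg (Icc X))
    (fun p => RInt (fun y => f (snd p) y (fst p)) (- Y) Y).
Proof.
  intros HY Hf; destruct (Icc_end Y HY) as [E1 E2].
  apply (continuous_on_RInt_param (prod_UniformSpace R_UniformSpace R_UniformSpace)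
    (prod_set R Rnneg (Icc X)) (Icc Y) _ (fun p y => f (snd p) y (fst p)) (- Y) Y
    (Icc_interval Y HY)); [|exact E2|exact E1|lra].
  apply (C0_along (prod_UniformSpace (prod_UniformSpace R_UniformSpace R_UniformSpace)
    R_UniformSpace) _ X Y f (fun p => snd (fst p)) (fun p => snd p)
    (fun p => fst (fst p)) Hf).
  - intros p [[H1 H2] H3]; auto.
  - apply (continuous_on_comp _ _ _ _ (fun _ => True) fst snd); auto;
      [apply continuous_on_fst|apply continuous_on_snd].
  - apply continuous_on_snd.
  - apply (continuous_on_comp _ _ _ _ (fun _ => True) fst fst); auto;
      apply continuous_on_fst.
Qed.

Lemma ex_RInt_slice_x (X Y : R) (f : field) (y t : R) :
  0 < X -> C0 X Y f -> Icc Y y -> Rnneg t -> ex_RInt (fun x => f x y t) (- X) X.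
Proof.
  intros HX Hf Hy Ht; destruct (Icc_end X HX).
  apply (continuous_on_ex_RInt (Icc X) _ _ _ _ (Icc_interval X HX)); auto.
  apply (C0_slice_x X Y); auto.
Qed.

Lemma ex_RInt_slice_y (X Y : R) (f : field) (x t : R) :
  0 < Y -> C0 X Y f -> Icc X x -> Rnneg t -> ex_RInt (fun y => f x y t) (- Y) Y.
Proof.
  intros HY Hf Hx Ht; destruct (Icc_end Y HY).
  apply (continuous_on_ex_RInt (Icc Y) _ _ _ _ (Icc_interval Y HY)); auto.
  apply (C0_slice_y X Y); auto.
Qed.

Lemma ex_RInt_outer (X Y : R) (f : field) (t : R) :
  0 < X -> 0 < Y -> C0 X Y f -> Rnneg t ->
  ex_RInt (fun x => RInt (fun y => f x y t) (- Y) Y) (- X) X.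
Proof.
  intros HX HY Hf Ht; destruct (Icc_end X HX).
  apply (continuous_on_ex_RInt (Icc X) _ _ _ _ (Icc_interval X HX)); auto.
  apply (continuous_on_slice R_UniformSpace Rnneg (Icc X)
    (fun t x => RInt (fun y => f x y t) (- Y) Y)); [|exact Ht].
  apply C0_y_integral; assumption.
Qed.

Lemma RInt_eq (f g : R -> R) (a b : R) :
  a <= b -> (forall x, a < x < b -> f x = g x) -> RInt f a b = RInt g a b.
Proof.
  intros Hab H; apply RInt_ext; intros x.
  rewrite Rmin_left, Rmax_right by exact Hab; apply H.
Qed.

Lemma rect_int_plus (X Y : R) (f g : field) (t : R) :
  0 < X -> 0 < Y -> C0 X Y f -> C0 X Y g -> Rnneg t ->
  rect_int X Y (fun x y t => f x y t + g x y t) t =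
  rect_int X Y f t + rect_int X Y g t.
Proof.
  intros HX HY Hf Hg Ht; unfold rect_int.
  rewrite <- (RInt_plus (V := R_CompleteNormedModule)
    (fun x => RInt (fun y => f x y t) (- Y) Y)
    (fun x => RInt (fun y => g x y t) (- Y) Y)) by (apply ex_RInt_outer; assumption).
  apply RInt_eq; [lra|]; intros x Hx.
  apply (RInt_plus (V := R_CompleteNormedModule));
    apply (ex_RInt_slice_y X Y); auto; unfold Icc; lra.
Qed.

Lemma rect_int_scal (X Y k : R) (f : field) (t : R) :
  0 < X -> 0 < Y -> C0 X Y f -> Rnneg t ->
  rect_int X Y (fun x y t => k * f x y t) t = k * rect_int X Y f t.
Proof.
  intros HX HY Hf Ht; unfold rect_int.
  rewrite <- (RInt_scal (V := R_CompleteNormedModule)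
    (fun x => RInt (fun y => f x y t) (- Y) Y)) by (apply ex_RInt_outer; assumption).
  apply RInt_eq; [lra|]; intros x Hx.
  apply (RInt_scal (V := R_CompleteNormedModule));
    apply (ex_RInt_slice_y X Y); auto; unfold Icc; lra.
Qed.

Lemma rect_int_le (X Y : R) (f g : field) (t : R) :
  0 < X -> 0 < Y -> C0 X Y f -> C0 X Y g -> Rnneg t ->
  (forall x y, Icc X x -> Icc Y y -> f x y t <= g x y t) ->
  rect_int X Y f t <= rect_int X Y g t.
Proof.
  intros HX HY Hf Hg Ht H.
  apply RInt_le; [lra|apply ex_RInt_outer; assumption..|].
  intros x Hx; assert (Icc X x) by (unfold Icc; lra).
  apply RInt_le; [lra|apply (ex_RInt_slice_y X Y); assumption..|].
  intros y Hy; apply H; [assumption|unfold Icc; lra].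
Qed.

Lemma L2norm_sqr (X Y : R) (f : field) (t : R) :
  0 < X -> 0 < Y -> C0 X Y f -> Rnneg t ->
  L2norm X Y (fun x y => f x y t) ^ 2 = rect_int X Y (fun x y t => f x y t ^ 2) t.
Proof.
  intros HX HY Hf Ht; unfold L2norm; rewrite pow2_sqrt; [reflexivity|].
  assert (H2 : C0 X Y (fun x y t => f x y t ^ 2)) by auto with C0.
  apply RInt_ge_0; [lra|exact (ex_RInt_outer X Y _ t HX HY H2 Ht)|].
  intros x Hx; apply RInt_ge_0; [lra| |intros; apply pow2_ge_0].
  apply (ex_RInt_slice_y X Y _ x t HY H2); [unfold Icc; lra|exact Ht].
Qed.

(** * Differentiation and divergence under the integral *)

Definition has_dx (X Y : R) (f g : field) : Prop :=
  forall x y t, Icc X x -> Icc Y y -> Rnneg t ->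
    is_derive_on (Icc X) (fun x' => f x' y t) x (g x y t).

Definition has_dy (X Y : R) (f g : field) : Prop :=
  forall x y t, Icc X x -> Icc Y y -> Rnneg t ->
    is_derive_on (Icc Y) (fun y' => f x y' t) y (g x y t).

Definition has_dt (X Y : R) (f g : field) : Prop :=
  forall x y t, Icc X x -> Icc Y y -> Rnneg t ->
    is_derive_on Rnneg (fun t' => f x y t') t (g x y t).

Lemma is_derive_on_rect_int (X Y : R) (f g : field) :
  0 < X -> 0 < Y -> C0 X Y f -> C0 X Y g -> has_dt X Y f g ->
  forall t, Rnneg t -> is_derive_on Rnneg (rect_int X Y f) t (rect_int X Y g t).
Proof.
  intros HX HY Hf Hg Hd; destruct (Icc_end X HX), (Icc_end Y HY).
  apply (is_derive_on_RInt_param Rnneg (Icc X) _ _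
    (fun t x => RInt (fun y => f x y t) (- Y) Y)
    (fun t x => RInt (fun y => g x y t) (- Y) Y) (- X) X
    Rnneg_interval (Icc_interval X HX)); auto; [| | |lra].
  - intros t x Ht Hx.
    apply (is_derive_on_RInt_param Rnneg (Icc Y) _ _
      (fun t y => f x y t) (fun t y => g x y t) (- Y) Y
      Rnneg_interval (Icc_interval Y HY)); auto; [| |lra].
    + intros s Hs; apply (C0_slice_y X Y); auto.
    + apply (C0_slice_ty X Y); auto.
  - intros t Ht; apply (continuous_on_slice R_UniformSpace Rnneg (Icc X)
      (fun t x => RInt (fun y => f x y t) (- Y) Y)); [|exact Ht].
    apply C0_y_integral; assumption.
  - apply C0_y_integral; assumption.
Qed.

(** The inner integral over [y] is a [C1] function of [x], so the fundamental theorem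
    applies to it directly and no exchange of the two integrations is needed. *)
Lemma rect_int_dx (X Y : R) (f g : field) (t : R) :
  0 < X -> 0 < Y -> C0 X Y f -> C0 X Y g -> has_dx X Y f g -> Rnneg t ->
  rect_int X Y g t = RInt (fun y => f X y t - f (- X) y t) (- Y) Y.
Proof.
  intros HX HY Hf Hg Hd Ht; destruct (Icc_end X HX), (Icc_end Y HY).
  transitivity (RInt (fun y => f X y t) (- Y) Y - RInt (fun y => f (- X) y t) (- Y) Y).
  - apply is_RInt_unique.
    apply (is_RInt_derive_on (Icc X) _ (fun x => RInt (fun y => f x y t) (- Y) Y)
      (fun x => RInt (fun y => g x y t) (- Y) Y) (- X) X (Icc_interval X HX)); auto.
    + intros x Hx.
      apply (is_derive_on_RInt_param (Icc X) (Icc Y) _ _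
        (fun x y => f x y t) (fun x y => g x y t) (- Y) Y
        (Icc_interval X HX) (Icc_interval Y HY)); auto; [| |lra].
      * intros s Hs; apply (C0_slice_y X Y); auto.
      * apply (C0_slice_xy X Y); auto.
    + apply (continuous_on_slice R_UniformSpace Rnneg (Icc X)
        (fun t x => RInt (fun y => g x y t) (- Y) Y)); [|exact Ht].
      apply C0_y_integral; assumption.
  - symmetry; apply (RInt_minus (V := R_CompleteNormedModule));
      apply (ex_RInt_slice_y X Y); auto.
Qed.

Lemma rect_int_dy (X Y : R) (f g : field) (t : R) :
  0 < X -> 0 < Y -> C0 X Y g -> has_dy X Y f g -> Rnneg t ->
  rect_int X Y g t = RInt (fun x => f x Y t - f x (- Y) t) (- X) X.
Proof.
  intros HX HY Hg Hd Ht; destruct (Icc_end Y HY).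
  apply RInt_eq; [lra|]; intros x Hx.
  assert (Icc X x) by (unfold Icc; lra).
  apply is_RInt_unique.
  apply (is_RInt_derive_on (Icc Y) _ (fun y => f x y t) (fun y => g x y t) (- Y) Y
    (Icc_interval Y HY)); auto.
  apply (C0_slice_y X Y); auto.
Qed.

(** * The energy inequality of the symmetrized system *)

(** In the derivative of the density [W], the products [u Ax + A ux] and
    [u By + B uy] are exact derivatives, which leaves the boundary fluxes; the terms
    with [sigma] are compared with [2 s W] point by point. *)
Lemma bulk_energy_rate (X Y s : R) (sigma : R -> R)
    (u A B p q ux uy Ax By : field) :
  0 < X -> 0 < Y ->
  continuous_on (Icc X) sigma ->
  (forall x, Icc X x -> 0 <= sigma x <= s) ->
  C0 X Y u -> C0 X Y A -> C0 X Y B -> C0 X Y p -> C0 X Y q ->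
  C0 X Y ux -> C0 X Y uy -> C0 X Y Ax -> C0 X Y By ->
  has_dx X Y u ux -> has_dy X Y u uy -> has_dx X Y A Ax -> has_dy X Y B By ->
  has_dt X Y u (fun x y t => Ax x y t + By x y t - sigma x * u x y t) ->
  has_dt X Y A (fun x y t => ux x y t - sigma x * A x y t) ->
  has_dt X Y B (fun x y t => uy x y t + sigma x * (B x y t - q x y t)) ->
  has_dt X Y p (fun x y t => - (sigma x * A x y t)) ->
  has_dt X Y q (fun x y t => sigma x * (B x y t - q x y t)) ->
  let W := fun x y t =>
    u x y t ^ 2 + A x y t ^ 2 + B x y t ^ 2 + p x y t ^ 2 + q x y t ^ 2 in
  forall t, Rnneg t -> exists l,
    is_derive_on Rnneg (rect_int X Y W) t l /\
    l <= 2 * s * rect_int X Y W t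
         + 2 * RInt (fun y => u X y t * A X y t - u (- X) y t * A (- X) y t) (- Y) Y
         + 2 * RInt (fun x => u x Y t * B x Y t - u x (- Y) t * B x (- Y) t) (- X) X.
Proof.
  intros HX HY Cs Hs Cu CA CB Cp Cq Cux Cuy CAx CBy Hux Huy HAx HBy Tu TA TB Tp Tq W t Ht.
  assert (Csf := C0_of_x X Y sigma Cs).
  pose (Px := fun x y t => ux x y t * A x y t + u x y t * Ax x y t).
  pose (Qy := fun x y t => uy x y t * B x y t + u x y t * By x y t).
  pose (G := fun x y t =>
    2 * u x y t * (Ax x y t + By x y t - sigma x * u x y t)
    + 2 * A x y t * (ux x y t - sigma x * A x y t)
    + 2 * B x y t * (uy x y t + sigma x * (B x y t - q x y t))
    + 2 * p x y t * (- (sigma x * A x y t))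
    + 2 * q x y t * (sigma x * (B x y t - q x y t))).
  assert (CW : C0 X Y W) by (unfold W; auto 12 with C0).
  assert (CP : C0 X Y Px) by (unfold Px; auto 12 with C0).
  assert (CQ : C0 X Y Qy) by (unfold Qy; auto 12 with C0).
  assert (CG : C0 X Y G) by (unfold G; auto 20 with C0).
  exists (rect_int X Y G t); split.
  - apply is_derive_on_rect_int; auto.
    intros x y t' Hx Hy Ht'; unfold W, G.
    repeat apply is_derive_on_plus; try exact Ht'.
    + apply (is_derive_on_sqr Rnneg (fun t => u x y t)); auto.
    + apply (is_derive_on_sqr Rnneg (fun t => A x y t)); auto.
    + apply (is_derive_on_sqr Rnneg (fun t => B x y t)); auto.
    + apply (is_derive_on_sqr Rnneg (fun t => p x y t)); auto.
    + apply (is_derive_on_sqr Rnneg (fun t => q x y t)); auto.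
  - rewrite <- (rect_int_dx X Y (fun x y t => u x y t * A x y t) Px t);
      auto with C0; [|intros x y t' Hx Hy Ht'; unfold Px;
        apply (is_derive_on_mult (Icc X) (fun x => u x y t') (fun x => A x y t')); auto].
    rewrite <- (rect_int_dy X Y (fun x y t => u x y t * B x y t) Qy t);
      auto; [|intros x y t' Hx Hy Ht'; unfold Qy;
        apply (is_derive_on_mult (Icc Y) (fun y => u x y t') (fun y => B x y t')); auto].
    rewrite <- !rect_int_scal, <- !rect_int_plus; auto with C0.
    apply rect_int_le; auto 12 with C0.
    intros x y Hx Hy; unfold G, W, Px, Qy; destruct (Hs x Hx) as [H0 H1].
    apply Rminus_le_0.
    (* The difference of the two sides is 2 (s - sigma) (u^2 + A^2 + B^2 + p^2 + q^2)
       + sigma (4 u^2 + 3 A^2 + p^2 + 4 q^2 + (A + p)^2). *)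
    pose (S := u x y t ^ 2 + A x y t ^ 2 + B x y t ^ 2 + p x y t ^ 2 + q x y t ^ 2).
    assert (HS : 0 <= (s - sigma x) * S).
    { apply Rmult_le_pos; [lra|unfold S].
      generalize (pow2_ge_0 (u x y t)) (pow2_ge_0 (A x y t)) (pow2_ge_0 (B x y t))
        (pow2_ge_0 (p x y t)) (pow2_ge_0 (q x y t)); lra. }
    assert (HR : 0 <= sigma x * (4 * u x y t ^ 2 + 3 * A x y t ^ 2
        + p x y t ^ 2 + 4 * q x y t ^ 2 + (A x y t + p x y t) ^ 2)).
    { apply Rmult_le_pos; [lra|].
      generalize (pow2_ge_0 (u x y t)) (pow2_ge_0 (A x y t)) (pow2_ge_0 (B x y t))
        (pow2_ge_0 (p x y t)) (pow2_ge_0 (q x y t))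
        (pow2_ge_0 (A x y t + p x y t)); lra. }
    eapply Rle_trans; [exact (Rplus_le_le_0_compat _ _
      (Rmult_le_pos 2 _ ltac:(lra) HS) HR)|right; unfold S; ring].
Qed.

(** * Partial derivatives of smooth fields *)

Lemma Dx_unique (X Y : R) (f g : field) :
  0 < X -> has_dx X Y f g ->
  forall x y t, Icc X x -> Icc Y y -> Rnneg t -> Dx X f x y t = g x y t.
Proof.
  intros HX H x y t Hx Hy Ht.
  apply (Derive_on_unique (Icc X) _ _ _ _ (Icc_interval X HX)); auto.
Qed.

Lemma Dy_unique (X Y : R) (f g : field) :
  0 < Y -> has_dy X Y f g ->
  forall x y t, Icc X x -> Icc Y y -> Rnneg t -> Dy Y f x y t = g x y t.
Proof.
  intros HY H x y t Hx Hy Ht.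
  apply (Derive_on_unique (Icc Y) _ (fun y => f x y t) _ _ (Icc_interval Y HY)); auto.
Qed.

Lemma Dt_unique (X Y : R) (f g : field) :
  has_dt X Y f g ->
  forall x y t, Icc X x -> Icc Y y -> Rnneg t -> Dt f x y t = g x y t.
Proof.
  intros H x y t Hx Hy Ht.
  apply (Derive_on_unique Rnneg _ (fun t => f x y t) _ _ Rnneg_interval); auto.
Qed.

Lemma C1_has_dx (X Y : R) (f : field) : 0 < X -> C1 X Y f -> has_dx X Y f (Dx X f).
Proof.
  intros HX [_ [H _]] x y t Hx Hy Ht.
  apply (Derive_on_correct (Icc X) _ _ _ (Icc_interval X HX)); [exact Hx|].
  apply H; assumption.
Qed.

Lemma C1_has_dy (X Y : R) (f : field) : 0 < Y -> C1 X Y f -> has_dy X Y f (Dy Y f).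
Proof.
  intros HY [_ [H _]] x y t Hx Hy Ht.
  apply (Derive_on_correct (Icc Y) _ _ _ (Icc_interval Y HY)); [exact Hy|].
  apply H; assumption.
Qed.

Lemma C1_has_dt (X Y : R) (f : field) : C1 X Y f -> has_dt X Y f (Dt f).
Proof.
  intros [_ [H _]] x y t Hx Hy Ht.
  apply (Derive_on_correct Rnneg _ _ _ Rnneg_interval); [exact Ht|].
  apply H; assumption.
Qed.

Lemma has_dt_ext (X Y : R) (f g h : field) :
  (forall x y t, Icc X x -> Icc Y y -> Rnneg t -> g x y t = h x y t) ->
  has_dt X Y f g -> has_dt X Y f h.
Proof. intros E H x y t Hx Hy Ht; rewrite <- E by assumption; auto. Qed.

(** Exchange of [Dt] and [Dx], knowing only that the time derivative is [C1] in
    [x]. *)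
Lemma has_dt_dx (X Y : R) (f fx ft fxt : field) :
  0 < X -> has_dx X Y f fx -> has_dt X Y f ft -> has_dx X Y ft fxt ->
  C0 X Y ft -> C0 X Y fxt -> has_dt X Y fx fxt.
Proof.
  intros HX Hx Ht Hxt Cft Cfxt x y t Ix Iy It.
  apply (is_derive_on_swap (Icc X) Rnneg _ _ (fun x t => f x y t) (fun x t => fx x y t)
    (fun x t => ft x y t) (fun x t => fxt x y t) 0 (Icc_interval X HX) Rnneg_interval);
    auto; try (intros; apply Hx || apply Ht || apply Hxt; assumption).
  - apply Rle_refl.
  - intros s Is; apply (C0_slice_t X Y); assumption.
  - apply (C0_slice_xt X Y); assumption.
Qed.

(** The counterpart of [has_dt_dx] in the direction [y]. *)
Lemma has_dt_dy (X Y : R) (f fy ft fyt : field) :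
  0 < Y -> has_dy X Y f fy -> has_dt X Y f ft -> has_dy X Y ft fyt ->
  C0 X Y ft -> C0 X Y fyt -> has_dt X Y fy fyt.
Proof.
  intros HY Hy Ht Hyt Cft Cfyt x y t Ix Iy It.
  apply (is_derive_on_swap (Icc Y) Rnneg _ _ (fun y t => f x y t) (fun y t => fy x y t)
    (fun y t => ft x y t) (fun y t => fyt x y t) 0 (Icc_interval Y HY) Rnneg_interval);
    auto; try (intros; apply Hy || apply Ht || apply Hyt; assumption).
  - apply Rle_refl.
  - intros s Is; apply (C0_slice_t X Y); assumption.
  - apply (C0_slice_yt X Y); assumption.
Qed.

(** * Regularity of the fluxes *)

Lemma C1_on_continuous (L : R) (g : R -> R) : C1_on L g -> continuous_on (Icc L) g.
Proof. intros [H _]; apply ex_derive_on_continuous_on; exact H. Qed.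

Lemma C0_flux_x (X Y : R) (sigma : R -> R) (Ez Hy : field) :
  C1_on X sigma -> C1 X Y Ez -> C1 X Y Hy -> C0 X Y (flux_x X sigma Ez Hy).
Proof.
  intros Cs CE CH; apply C0_plus; [apply CE|].
  apply (C0_mult X Y (fun x _ _ => sigma x)); [|apply CH].
  apply C0_of_x, C1_on_continuous, Cs.
Qed.

Lemma C0_flux_y (X Y : R) (sigma : R -> R) (Ez Hx : field) :
  C1_on X sigma -> C1 X Y Ez -> C1 X Y Hx -> C0 X Y (flux_y Y sigma Ez Hx).
Proof.
  intros Cs CE CH; apply C0_plus; [apply CE|].
  apply (C0_mult X Y (fun x _ _ => sigma x)); [|apply CH].
  apply C0_of_x, C1_on_continuous, Cs.
Qed.

Lemma flux_x_has_dx (X Y : R) (sigma : R -> R) (Ez Hy : field) :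
  0 < X -> C1_on X sigma -> C1 X Y (Dx X Ez) -> C1 X Y Hy ->
  has_dx X Y (flux_x X sigma Ez Hy)
    (fun x y t => Dx X (Dx X Ez) x y t
       + (Derive_on (Icc X) sigma x * Hy x y t + sigma x * Dx X Hy x y t)).
Proof.
  intros HX Cs CE CH x y t Ix Iy It; apply is_derive_on_plus; [exact Ix| |].
  - apply (C1_has_dx X Y _ HX CE); assumption.
  - apply (is_derive_on_mult (Icc X) sigma (fun x => Hy x y t)); [exact Ix| |].
    + apply (Derive_on_correct (Icc X) _ _ _ (Icc_interval X HX)); [exact Ix|].
      apply Cs; exact Ix.
    + apply (C1_has_dx X Y _ HX CH); assumption.
Qed.

Lemma flux_y_has_dy (X Y : R) (sigma : R -> R) (Ez Hx : field) :
  0 < Y -> C1 X Y (Dy Y Ez) -> C1 X Y Hx ->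
  has_dy X Y (flux_y Y sigma Ez Hx)
    (fun x y t => Dy Y (Dy Y Ez) x y t + sigma x * Dy Y Hx x y t).
Proof.
  intros HY CE CH x y t Ix Iy It; apply is_derive_on_plus; [exact Iy| |].
  - apply (C1_has_dy X Y _ HY CE); assumption.
  - apply (is_derive_on_scal (Icc Y) (sigma x) (fun y => Hx x y t)); [exact Iy|].
    apply (C1_has_dy X Y _ HY CH); assumption.
Qed.

Lemma flux_x_Dx (X Y : R) (sigma : R -> R) (Ez Hy : field) :
  0 < X -> C1_on X sigma -> C1 X Y (Dx X Ez) -> C1 X Y Hy ->
  has_dx X Y (flux_x X sigma Ez Hy) (Dx X (flux_x X sigma Ez Hy)) /\
  C0 X Y (Dx X (flux_x X sigma Ez Hy)).
Proof.
  intros HX Cs CE CH.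
  assert (Hd := flux_x_has_dx X Y sigma Ez Hy HX Cs CE CH).
  assert (E := Dx_unique X Y _ _ HX Hd); split.
  - intros x y t Ix Iy It; rewrite E by assumption; auto.
  - eapply C0_ext; [intros; symmetry; apply E; assumption|].
    apply C0_plus; [apply CE|apply C0_plus].
    + apply (C0_mult X Y (fun x _ _ => Derive_on (Icc X) sigma x)); [|apply CH].
      apply C0_of_x, Cs.
    + apply (C0_mult X Y (fun x _ _ => sigma x)); [|apply CH].
      apply C0_of_x, C1_on_continuous, Cs.
Qed.

Lemma flux_y_Dy (X Y : R) (sigma : R -> R) (Ez Hx : field) :
  0 < Y -> C1_on X sigma -> C1 X Y (Dy Y Ez) -> C1 X Y Hx ->
  has_dy X Y (flux_y Y sigma Ez Hx) (Dy Y (flux_y Y sigma Ez Hx)) /\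
  C0 X Y (Dy Y (flux_y Y sigma Ez Hx)).
Proof.
  intros HY Cs CE CH.
  assert (Hd := flux_y_has_dy X Y sigma Ez Hx HY CE CH).
  assert (E := Dy_unique X Y _ _ HY Hd); split.
  - intros x y t Ix Iy It; rewrite E by assumption; auto.
  - eapply C0_ext; [intros; symmetry; apply E; assumption|].
    apply C0_plus; [apply CE|].
    apply (C0_mult X Y (fun x _ _ => sigma x)); [|apply CH].
    apply C0_of_x, C1_on_continuous, Cs.
Qed.

(** * From the first order to the second order system *)

(** Time differentiation of the equation of [Ez] removes [Hxs]: its time derivative
    [sigma Dy Hx] is exactly the term that completes [Dy (Dy Ez)] to the
    derivative of the flux in [y], because [sigma] does not depend on [y]. *)
Lemma first_order_second_order (X Y : R) (sigma : R -> R) (Ez Hy Hx Hxs : field) :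
  0 < X -> 0 < Y -> C1_on X sigma ->
  first_order_pml X Y sigma Ez Hy Hx Hxs -> second_order_pml X Y sigma Ez Hy Hx.
Proof.
  intros HX HY Cs [CE2 CHy CHx CHxs eE eHy eHx eHxs].
  split; [exact CE2|exact CHy|exact CHx| |exact eHy|exact eHx].
  destruct CE2 as [CE [CEx [CEy CEt]]].
  intros x y t Ix Iy It.
  destruct (flux_x_Dx X Y sigma Ez Hy HX Cs CEx CHy) as [Fd Fc].
  (* Here Dt Hy is - flux_x, which is differentiable in x although Hy is only C1. *)
  assert (THyx : has_dt X Y (Dx X Hy) (fun x y t => - Dx X (flux_x X sigma Ez Hy) x y t)).
  { apply (has_dt_dx X Y Hy (Dx X Hy) (fun x y t => - flux_x X sigma Ez Hy x y t)); auto.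
    - apply C1_has_dx; assumption.
    - apply has_dt_ext with (Dt Hy); [|apply C1_has_dt, CHy].
      intros; rewrite eHy by assumption; unfold flux_x; ring.
    - intros a b r Ia Ib Ir.
      apply (is_derive_on_opp (Icc X) (fun x => flux_x X sigma Ez Hy x b r)); auto.
    - apply C0_opp, C0_flux_x; assumption.
    - apply C0_opp, Fc. }
  assert (THxy : has_dt X Y (Dy Y Hx) (Dy Y (Dy Y Ez))).
  { apply (has_dt_dy X Y Hx (Dy Y Hx) (Dy Y Ez)); auto.
    - apply C1_has_dy; assumption.
    - apply has_dt_ext with (Dt Hx); [exact eHx|apply C1_has_dt, CHx].
    - apply C1_has_dy; assumption.
    - apply CEy.
    - apply CEy. }
  assert (TEt : has_dt X Y (Dt Ez) (fun x y t =>
    - - Dx X (flux_x X sigma Ez Hy) x y t + Dy Y (Dy Y Ez) x y t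
    + sigma x * Dy Y Hx x y t - sigma x * Dt Ez x y t)).
  { intros a b r Ia Ib Ir.
    apply is_derive_on_ext with
      (fun t => - Dx X Hy a b t + Dy Y Hx a b t + Hxs a b t - sigma a * Ez a b t);
      [exact Ir|intros; symmetry; auto|].
    apply is_derive_on_minus; [exact Ir| |].
    - apply is_derive_on_plus; [exact Ir| |].
      + apply is_derive_on_plus; [exact Ir| |apply THxy; assumption].
        apply (is_derive_on_opp Rnneg (fun t => Dx X Hy a b t)); auto.
      + rewrite <- eHxs by assumption; apply (C1_has_dt X Y); assumption.
    - apply (is_derive_on_scal Rnneg (sigma a) (fun t => Ez a b t)); auto.
      apply (C1_has_dt X Y); assumption. }
  rewrite (Dt_unique X Y _ _ TEt) by assumption.
  rewrite (Dy_unique X Y _ _ HY (flux_y_has_dy X Y sigma Ez Hx HY CEy CHx)) by assumption.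
  ring.
Qed.

(** * Boundary conditions differentiated in time *)

(** Differentiating the impedance relations in time turns [Dt Hy] and [Dt Hx] into
    [- flux_x] and [Dy Ez].  On the edges [y = -Y, Y] the relation itself, multiplied
    by [sigma], is added in order to complete [Dy Ez] to the flux. *)
Lemma impedance_bc_implied (X Y gx gy : R) (sigma : R -> R) (Ez Hy Hx : field) :
  0 < X -> 0 < Y -> second_order_pml X Y sigma Ez Hy Hx ->
  impedance_bc X Y gx gy Ez Hy Hx -> implied_impedance_bc X Y gx gy sigma Ez Hy Hx.
Proof.
  intros HX HY [[CE _] CHy CHx _ eHy eHx] [By Bx].
  destruct (Icc_end X HX) as [X1 X2], (Icc_end Y HY) as [Y1 Y2].
  assert (Z : forall (k : R) (f g : R -> R) (a b t : R), Rnneg t ->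
    is_derive_on Rnneg f t a -> is_derive_on Rnneg g t b ->
    (forall t, Rnneg t -> k * f t + g t = 0) -> k * a + b = 0).
  { intros k f g a b t Ht Ha Hb E.
    apply (is_derive_on_unique Rnneg _ (fun _ => 0) t _ _ Rnneg_interval Ht);
      [|apply is_derive_on_const, Ht].
    apply is_derive_on_ext with (fun t => k * f t + g t); auto.
    apply is_derive_on_plus; auto; apply is_derive_on_scal; auto. }
  assert (TE := C1_has_dt X Y Ez CE).
  assert (THy := C1_has_dt X Y Hy CHy); assert (THx := C1_has_dt X Y Hx CHx).
  unfold implied_impedance_bc, flux_x, flux_y; split.
  - intros x t Ix It; destruct (By x t Ix It) as [B1 B2].
    assert (E1 := Z gy _ _ _ _ t It (TE x Y t Ix Y1 It) (THx x Y t Ix Y1 It)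
      (fun r Ir => proj1 (By x r Ix Ir))).
    assert (E2 := Z gy _ _ _ _ t It (TE x (- Y) t Ix Y2 It)
      (is_derive_on_opp _ _ _ _ It (THx x (- Y) t Ix Y2 It))
      (fun r Ir => proj2 (By x r Ix Ir))).
    rewrite eHx in E1, E2 by assumption; split.
    + generalize (Rmult_eq_compat_l (sigma x) _ _ B1); lra.
    + generalize (Rmult_eq_compat_l (sigma x) _ _ B2); lra.
  - intros y t Iy It.
    assert (E1 := Z gx _ _ _ _ t It (TE X y t X1 Iy It)
      (is_derive_on_opp _ _ _ _ It (THy X y t X1 Iy It))
      (fun r Ir => proj1 (Bx y r Iy Ir))).
    assert (E2 := Z gx _ _ _ _ t It (TE (- X) y t X2 Iy It) (THy (- X) y t X2 Iy It)
      (fun r Ir => proj2 (Bx y r Iy Ir))).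
    rewrite eHy in E1, E2 by assumption; split; lra.
Qed.

Lemma zero_bc_Dt (X Y : R) (f : field) : zero_bc X Y f -> zero_bc X Y (Dt f).
Proof.
  intros [By Bx].
  assert (Z : forall (g : R -> R) t, Rnneg t -> (forall r, Rnneg r -> g r = 0) ->
    Derive_on Rnneg g t = 0).
  { intros g t Ht E; apply (Derive_on_unique Rnneg _ _ _ _ Rnneg_interval Ht).
    apply is_derive_on_ext with (fun _ => 0); [exact Ht|intros; symmetry; auto|].
    apply is_derive_on_const, Ht. }
  split; intros z t Iz It; split; apply Z; try exact It; intros r Ir;
    (apply By || apply Bx); assumption.
Qed.

(** * Growth of the energies *)

(** The instance of [bulk_energy_rate] for the layer.  The equations of [A] and [B]
    use [Dt (Dx Ez) = Dx (Dt Ez)] and [Dt (Dy Ez) = Dy (Dt Ez)]. *)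
Lemma energy0_rate (X Y s : R) (sigma : R -> R) (Ez Hy Hx : field) :
  0 < X -> 0 < Y -> C1_on X sigma -> (forall x, Icc X x -> 0 <= sigma x <= s) ->
  second_order_pml X Y sigma Ez Hy Hx ->
  forall t, Rnneg t -> exists l,
    is_derive_on Rnneg (energy0 X Y sigma Ez Hy Hx) t l /\
    l <= 2 * s * energy0 X Y sigma Ez Hy Hx t
         + 2 * RInt (fun y => Dt Ez X y t * flux_x X sigma Ez Hy X y t
                 - Dt Ez (- X) y t * flux_x X sigma Ez Hy (- X) y t) (- Y) Y
         + 2 * RInt (fun x => Dt Ez x Y t * flux_y Y sigma Ez Hx x Y t
                 - Dt Ez x (- Y) t * flux_y Y sigma Ez Hx x (- Y) t) (- X) X.
Proof.
  intros HX HY Cs Hs [[CE [CEx [CEy CEt]]] CHy CHx eE eHy eHx] t Ht.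
  set (A := flux_x X sigma Ez Hy); set (B := flux_y Y sigma Ez Hx).
  set (p := fun x y t => sigma x * Hy x y t).
  set (q := fun x y t => sigma x * Hx x y t).
  assert (Cs0 := C1_on_continuous X sigma Cs).
  assert (Csf := C0_of_x X Y sigma Cs0).
  assert (CA : C0 X Y A) by (apply C0_flux_x; assumption).
  assert (CB : C0 X Y B) by (apply C0_flux_y; assumption).
  assert (Cp : C0 X Y p)
    by (apply (C0_mult X Y (fun x _ _ => sigma x)); [|apply CHy]; auto).
  assert (Cq : C0 X Y q)
    by (apply (C0_mult X Y (fun x _ _ => sigma x)); [|apply CHx]; auto).
  assert (Cu : C0 X Y (Dt Ez)) by apply CE.
  destruct (flux_x_Dx X Y sigma Ez Hy HX Cs CEx CHy) as [HAx CAx].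
  destruct (flux_y_Dy X Y sigma Ez Hx HY Cs CEy CHx) as [HBy CBy].
  assert (Hux := C1_has_dx X Y _ HX CEt); assert (Huy := C1_has_dy X Y _ HY CEt).
  assert (Tu := C1_has_dt X Y _ CEt).
  assert (Tp : has_dt X Y p (fun x y t => - (sigma x * A x y t))).
  { intros a b r Ia Ib Ir.
    replace (- (sigma a * A a b r)) with (sigma a * Dt Hy a b r)
      by (rewrite eHy by assumption; unfold A, flux_x; ring).
    apply is_derive_on_scal; [exact Ir|]; apply (C1_has_dt X Y); assumption. }
  assert (Tq : has_dt X Y q (fun x y t => sigma x * (B x y t - q x y t))).
  { intros a b r Ia Ib Ir.
    replace (sigma a * (B a b r - q a b r)) with (sigma a * Dt Hx a b r)
      by (rewrite eHx by assumption; unfold B, q, flux_y; ring).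
    apply is_derive_on_scal; [exact Ir|]; apply (C1_has_dt X Y); assumption. }
  assert (TEx : has_dt X Y (Dx X Ez) (Dx X (Dt Ez))).
  { apply (has_dt_dx X Y Ez _ (Dt Ez)); auto;
      [apply C1_has_dx|apply C1_has_dt|apply CEt]; assumption. }
  assert (TEy : has_dt X Y (Dy Y Ez) (Dy Y (Dt Ez))).
  { apply (has_dt_dy X Y Ez _ (Dt Ez)); auto;
      [apply C1_has_dy|apply C1_has_dt|apply CEt]; assumption. }
  assert (HW : forall t, Rnneg t -> energy0 X Y sigma Ez Hy Hx t =
    rect_int X Y (fun x y t => Dt Ez x y t ^ 2 + A x y t ^ 2 + B x y t ^ 2
      + p x y t ^ 2 + q x y t ^ 2) t).
  { intros r Ir.
    rewrite !rect_int_plus by auto 12 with C0.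
    rewrite <- (L2norm_sqr X Y (Dt Ez) r), <- (L2norm_sqr X Y A r),
      <- (L2norm_sqr X Y B r), <- (L2norm_sqr X Y p r), <- (L2norm_sqr X Y q r)
      by assumption.
    reflexivity. }
  destruct (bulk_energy_rate X Y s sigma (Dt Ez) A B p q (Dx X (Dt Ez)) (Dy Y (Dt Ez))
    (Dx X A) (Dy Y B)) with (t := t) as [l [Hl Hle]]; auto.
  - apply CEt.
  - apply CEt.
  - apply has_dt_ext with (2 := Tu); intros x y r Ix Iy Ir.
    generalize (eE x y r Ix Iy Ir); unfold A, B; lra.
  - intros a b r Ia Ib Ir.
    replace (Dx X (Dt Ez) a b r - sigma a * A a b r)
      with (Dx X (Dt Ez) a b r + - (sigma a * A a b r)) by ring.
    apply is_derive_on_plus; [exact Ir|apply TEx|apply Tp]; assumption.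
  - intros a b r Ia Ib Ir.
    apply is_derive_on_plus; [exact Ir|apply TEy|apply Tq]; assumption.
  - exists l; split.
    + apply is_derive_on_ext with (2 := fun r Ir => eq_sym (HW r Ir)); assumption.
    + rewrite (HW t Ht); exact Hle.
Qed.

Lemma RInt_zero (f : R -> R) (a b : R) :
  a <= b -> (forall x, a < x < b -> f x = 0) -> RInt f a b = 0.
Proof.
  intros Hab H; rewrite (RInt_eq f (fun _ => 0) a b Hab H), RInt_const.
  unfold scal; simpl; unfold mult; simpl; ring.
Qed.

Lemma zero_bc_growth (X Y s : R) (sigma : R -> R) (Ez Hy Hx : field) :
  0 < X -> 0 < Y -> C1_on X sigma -> (forall x, Icc X x -> 0 <= sigma x <= s) ->
  second_order_pml X Y sigma Ez Hy Hx -> zero_bc X Y (Dt Ez) ->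
  sqrt_growth_le (energy0 X Y sigma Ez Hy Hx) s.
Proof.
  intros HX HY Cs Hs S [By Bx] t Ht.
  destruct (energy0_rate X Y s sigma Ez Hy Hx HX HY Cs Hs S t Ht) as [l [Hl Hle]].
  exists l; split; [exact Hl|]; rewrite !RInt_zero in Hle; [lra|lra| |lra|];
    intros z Hz.
  - destruct (By z t) as [-> ->]; [unfold Icc; lra|exact Ht|ring].
  - destruct (Bx z t) as [-> ->]; [unfold Icc; lra|exact Ht|ring].
Qed.

Lemma RInt_comb (f g : R -> R) (k m a b : R) :
  ex_RInt f a b -> ex_RInt g a b ->
  RInt (fun x => k * f x + m * g x) a b = k * RInt f a b + m * RInt g a b.
Proof.
  intros Hf Hg.
  transitivity (RInt (fun x => k * f x) a b + RInt (fun x => m * g x) a b).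
  - apply (RInt_plus (V := R_CompleteNormedModule));
      apply (ex_RInt_scal (V := R_NormedModule)); assumption.
  - f_equal; apply (RInt_scal (V := R_CompleteNormedModule)); assumption.
Qed.

(** Edge values as fields that are constant in the transverse variable, so that the
    rules for [C0] also give the integrability of edge integrands. *)
Lemma C0_at_x (X Y x0 : R) (f : field) :
  C0 X Y f -> Icc X x0 -> C0 X Y (fun _ y t => f x0 y t).
Proof.
  intros Hf Hx.
  apply (C0_along (prod_UniformSpace (prod_UniformSpace R_UniformSpace R_UniformSpace)
    R_UniformSpace) (dom X Y) X Y f (fun _ => x0) (fun p => snd (fst p))
    (fun p => snd p) Hf).
  - intros p [_ [Hy Ht]]; auto.
  - apply continuous_on_const.
  - apply (continuous_on_comp _ _ _ _ (fun _ => True) fst snd); auto;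
      [apply continuous_on_fst|apply continuous_on_snd].
  - apply continuous_on_snd.
Qed.

Lemma C0_at_y (X Y y0 : R) (f : field) :
  C0 X Y f -> Icc Y y0 -> C0 X Y (fun x _ t => f x y0 t).
Proof.
  intros Hf Hy.
  apply (C0_along (prod_UniformSpace (prod_UniformSpace R_UniformSpace R_UniformSpace)
    R_UniformSpace) (dom X Y) X Y f (fun p => fst (fst p)) (fun _ => y0)
    (fun p => snd p) Hf).
  - intros p [Hx [_ Ht]]; auto.
  - apply (continuous_on_comp _ _ _ _ (fun _ => True) fst fst); auto;
      apply continuous_on_fst.
  - apply continuous_on_const.
  - apply continuous_on_snd.
Qed.

(** The flux through the edges in [x] is [- gx] times the dissipation integral there,
    and the flux through the edges in [y] is [- gy] times the dissipation integral
    minus half of the derivative of the boundary energy.  As fluxes count twice in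
    [energy0_rate], the derivative of [energy1] keeps one nonpositive copy of each
    dissipation integral. *)
Lemma impedance_growth (X Y gx gy s : R) (sigma : R -> R) (Ez Hy Hx : field) :
  0 < X -> 0 < Y -> 0 <= gx -> 0 <= gy ->
  C1_on X sigma -> (forall x, Icc X x -> 0 <= sigma x <= s) ->
  second_order_pml X Y sigma Ez Hy Hx ->
  implied_impedance_bc X Y gx gy sigma Ez Hy Hx ->
  sqrt_growth_le (energy1 X Y gx gy sigma Ez Hy Hx) s.
Proof.
  intros HX HY Hgx Hgy Cs Hs S [By Bx] t Ht.
  destruct (energy0_rate X Y s sigma Ez Hy Hx HX HY Cs Hs S t Ht) as [l [Hl Hle]].
  destruct S as [[CE [_ [_ CEt]]] _ _ _ _ _].
  destruct (Icc_end X HX) as [X1 X2], (Icc_end Y HY) as [Y1 Y2].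
  assert (Csf := C0_of_x X Y sigma (C1_on_continuous X sigma Cs)).
  assert (C0E : C0 X Y Ez) by apply CE.
  assert (C0u : C0 X Y (Dt Ez)) by apply CE.
  assert (TE := C1_has_dt X Y Ez CE).
  pose (S := fun x (_ : R) t => gy * sigma x * (Ez x (- Y) t ^ 2 + Ez x Y t ^ 2)).
  pose (S' := fun x (_ : R) t => gy * sigma x
    * (2 * Ez x (- Y) t * Dt Ez x (- Y) t + 2 * Ez x Y t * Dt Ez x Y t)).
  pose (Ux := fun x (_ : R) t => Dt Ez x (- Y) t ^ 2 + Dt Ez x Y t ^ 2).
  pose (Uy := fun (_ : R) y t => Dt Ez X y t ^ 2 + Dt Ez (- X) y t ^ 2).
  assert (CEp := C0_at_y X Y Y Ez C0E Y1); assert (CEm := C0_at_y X Y (- Y) Ez C0E Y2).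
  assert (Cup := C0_at_y X Y Y _ C0u Y1); assert (Cum := C0_at_y X Y (- Y) _ C0u Y2).
  assert (Cur := C0_at_x X Y X _ C0u X1); assert (Cul := C0_at_x X Y (- X) _ C0u X2).
  assert (CS : C0 X Y S) by (unfold S; auto 12 with C0).
  assert (CS' : C0 X Y S') by (unfold S'; auto 12 with C0).
  assert (CUx : C0 X Y Ux) by (unfold Ux; auto 12 with C0).
  assert (CUy : C0 X Y Uy) by (unfold Uy; auto 12 with C0).
  pose (D := fun t => gy * RInt (fun x => Ux x Y t) (- X) X
                      + gx * RInt (fun y => Uy X y t) (- Y) Y).
  assert (CD : continuous_on Rnneg D).
  { apply continuous_on_plus; apply continuous_on_mult;
      try apply continuous_on_const.
    - apply (continuous_on_RInt_param R_UniformSpace Rnneg (Icc X) _ (fun t x => Ux x Y t)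
        (- X) X (Icc_interval X HX)); auto; [|lra].
      apply (C0_slice_tx X Y); assumption.
    - apply (continuous_on_RInt_param R_UniformSpace Rnneg (Icc Y) _ (fun t y => Uy X y t)
        (- Y) Y (Icc_interval Y HY)); auto; [|lra].
      apply (C0_slice_ty X Y); assumption. }
  assert (DS : is_derive_on Rnneg (fun t => RInt (fun x => S x Y t) (- X) X) t
                 (RInt (fun x => S' x Y t) (- X) X)).
  { apply (is_derive_on_RInt_param Rnneg (Icc X) _ _ (fun t x => S x Y t)
      (fun t x => S' x Y t) (- X) X Rnneg_interval (Icc_interval X HX)); auto; [| | |lra].
    - intros r x Ir Ix; apply is_derive_on_scal; [exact Ir|].
      apply is_derive_on_plus; [exact Ir| |].
      + apply (is_derive_on_sqr Rnneg (fun t => Ez x (- Y) t)); auto.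
      + apply (is_derive_on_sqr Rnneg (fun t => Ez x Y t)); auto.
    - intros r Ir; apply (C0_slice_x X Y); assumption.
    - apply (C0_slice_tx X Y); assumption. }
  assert (R0 : Rnneg 0) by apply Rle_refl.
  exists (l + RInt (fun x => S' x Y t) (- X) X + D t); split.
  - apply is_derive_on_plus; [exact Ht|apply is_derive_on_plus; assumption|].
    exact (is_derive_on_RInt_upper Rnneg _ D 0 t Rnneg_interval CD R0 Ht).
  - assert (Fy : RInt (fun y => Dt Ez X y t * flux_x X sigma Ez Hy X y t
        - Dt Ez (- X) y t * flux_x X sigma Ez Hy (- X) y t) (- Y) Y
        = - gx * RInt (fun y => Uy X y t) (- Y) Y).
    { transitivity (RInt (fun y => - gx * Uy X y t) (- Y) Y);
        [|apply (RInt_scal (V := R_CompleteNormedModule));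
          apply (ex_RInt_slice_y X Y); assumption].
      apply RInt_eq; [lra|]; intros y Iy.
      destruct (Bx y t) as [B1 B2]; [unfold Icc; lra|exact Ht|].
      unfold Uy.
      replace (flux_x X sigma Ez Hy X y t) with (- (gx * Dt Ez X y t)) by lra.
      replace (flux_x X sigma Ez Hy (- X) y t) with (gx * Dt Ez (- X) y t) by lra.
      ring. }
    assert (Fx : RInt (fun x => Dt Ez x Y t * flux_y Y sigma Ez Hx x Y t
        - Dt Ez x (- Y) t * flux_y Y sigma Ez Hx x (- Y) t) (- X) X
        = - gy * RInt (fun x => Ux x Y t) (- X) X
          + (- / 2) * RInt (fun x => S' x Y t) (- X) X).
    { rewrite <- RInt_comb by (apply (ex_RInt_slice_x X Y); assumption).
      apply RInt_eq; [lra|]; intros x Ix.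
      destruct (By x t) as [B1 B2]; [unfold Icc; lra|exact Ht|].
      unfold Ux, S'.
      replace (flux_y Y sigma Ez Hx x Y t)
        with (- (gy * Dt Ez x Y t + sigma x * gy * Ez x Y t)) by lra.
      replace (flux_y Y sigma Ez Hx x (- Y) t)
        with (gy * Dt Ez x (- Y) t + sigma x * gy * Ez x (- Y) t) by lra.
      field. }
    assert (S0 : 0 <= RInt (fun x => S x Y t) (- X) X).
    { apply RInt_ge_0; [lra|apply (ex_RInt_slice_x X Y); assumption|].
      intros x Ix; apply Rmult_le_pos.
      - apply Rmult_le_pos; [exact Hgy|apply Hs; unfold Icc; lra].
      - apply Rplus_le_le_0_compat; apply pow2_ge_0. }
    assert (Ux0 : forall r, Rnneg r -> 0 <= RInt (fun x => Ux x Y r) (- X) X).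
    { intros r Ir; apply RInt_ge_0; [lra|apply (ex_RInt_slice_x X Y); assumption|].
      intros x _; apply Rplus_le_le_0_compat; apply pow2_ge_0. }
    assert (Uy0 : forall r, Rnneg r -> 0 <= RInt (fun y => Uy X y r) (- Y) Y).
    { intros r Ir; apply RInt_ge_0; [lra|apply (ex_RInt_slice_y X Y); assumption|].
      intros y _; apply Rplus_le_le_0_compat; apply pow2_ge_0. }
    assert (ID : 0 <= RInt D 0 t).
    { apply RInt_ge_0; [exact Ht|
        apply (continuous_on_ex_RInt Rnneg _ D 0 t Rnneg_interval);
        assumption|].
      intros r Ir; assert (Rnneg r) by (unfold Rnneg; lra).
      apply Rplus_le_le_0_compat; apply Rmult_le_pos; auto. }
    assert (s0 : 0 <= s) by (destruct (Hs X X1); lra).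
    change (energy1 X Y gx gy sigma Ez Hy Hx t) with
      (energy0 X Y sigma Ez Hy Hx t + RInt (fun x => S x Y t) (- X) X + RInt D 0 t).
    rewrite Fx, Fy in Hle; unfold D at 1.
    generalize (Rmult_le_pos _ _ Hgx (Uy0 t Ht)) (Rmult_le_pos _ _ Hgy (Ux0 t Ht))
      (Rmult_le_pos _ _ s0 S0) (Rmult_le_pos _ _ s0 ID); lra.
Qed.

Theorem theorem4p5 (x0 y0 delta gx gy : R) (sigma : R -> R) (sigma_inf : R)
    (hx0 : 0 < x0) (hy0 : 0 < y0) (hdelta : 0 < delta)
    (hgx : 0 <= gx) (hgy : 0 <= gy)
    (hsigma : damping x0 delta sigma)
    (hsigma_inf : is_max_on (Icc (x0 + delta)) sigma sigma_inf) :
  ((forall Ez Hy Hx Hxs : field,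
      first_order_pml (x0 + delta) y0 sigma Ez Hy Hx Hxs ->
      impedance_bc (x0 + delta) y0 gx gy Ez Hy Hx ->
      implied_impedance_bc (x0 + delta) y0 gx gy sigma Ez Hy Hx /\
      sqrt_growth_le (energy1 (x0 + delta) y0 gx gy sigma Ez Hy Hx) sigma_inf) /\
   (forall Ez Hy Hx : field,
      second_order_pml (x0 + delta) y0 sigma Ez Hy Hx ->
      implied_impedance_bc (x0 + delta) y0 gx gy sigma Ez Hy Hx ->
      sqrt_growth_le (energy1 (x0 + delta) y0 gx gy sigma Ez Hy Hx) sigma_inf)) /\
  ((forall Ez Hy Hx Hxs : field,
      first_order_pml (x0 + delta) y0 sigma Ez Hy Hx Hxs ->
      zero_bc (x0 + delta) y0 Ez ->
      zero_bc (x0 + delta) y0 (Dt Ez) /\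
      sqrt_growth_le (energy0 (x0 + delta) y0 sigma Ez Hy Hx) sigma_inf) /\
   (forall Ez Hy Hx : field,
      second_order_pml (x0 + delta) y0 sigma Ez Hy Hx ->
      zero_bc (x0 + delta) y0 Ez ->
      zero_bc (x0 + delta) y0 (Dt Ez) /\
      sqrt_growth_le (energy0 (x0 + delta) y0 sigma Ez Hy Hx) sigma_inf)).
Proof.
  assert (hX : 0 < x0 + delta) by lra.
  destruct hsigma as [Cs sge0 _]; destruct hsigma_inf as [_ smax].
  assert (Hs : forall x, Icc (x0 + delta) x -> 0 <= sigma x <= sigma_inf) by auto.
  split; split.
  - intros Ez Hy Hx Hxs F B.
    assert (F2 := first_order_second_order _ _ _ _ _ _ _ hX hy0 Cs F).
    assert (B2 := impedance_bc_implied _ _ _ _ _ _ _ _ hX hy0 F2 B).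
    split; [exact B2|apply impedance_growth; assumption].
  - intros Ez Hy Hx F2 B2; apply impedance_growth; assumption.
  - intros Ez Hy Hx Hxs F B.
    assert (F2 := first_order_second_order _ _ _ _ _ _ _ hX hy0 Cs F).
    split; [|apply zero_bc_growth]; auto using zero_bc_Dt.
  - intros Ez Hy Hx F2 B.
    split; [|apply zero_bc_growth]; auto using zero_bc_Dt.
Qed.
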